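(* Let $K$ be a compact line. The following statements are equivalent: (a) $K$ is $\aleph_0$-monolithic; (b) $C(K)$ has the $c_0$-extension property; (c) $C(K)$ has the separable $c_0$-extension property.
   Context: A compact line is a (nonempty) linearly ordered set which is compact in the order topology. $C(K)$ denotes the Banach space of continuous real-valued functions on $K$ with the supremum norm; Banach spaces are real. A compact Hausdorff space $K$ is $\aleph_0$-monolithic if every separable subspace of $K$ is metrizable. A closed subspace $Y$ of a Banach space $X$ has the $c_0$-extension property in $X$ if every bounded operator $T:Y\to c_0$ admits a bounded extension $X\to c_0$. A Banach space $X$ has the $c_0$-extension property (resp., the separable $c_0$-extension property) if every closed subspace (resp., every separable closed subspace) of $X$ has the $c_0$-extension property in $X$. *)

(* Defs.v *)
From HB Require Import structures.
From mathcomp Require Import all_boot all_order all_algebra.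
From mathcomp Require Import all_classical all_reals all_analysis.
From mathcomp Require Import ring.

Set Implicit Arguments.
Unset Strict Implicit.
Unset Printing Implicit Defensive.

Import Order.TTheory GRing.Theory Num.Theory.
Import numFieldNormedType.Exports.

Local Open Scope classical_set_scope.
Local Open Scope ring_scope.

Definition separable (T : topologicalType) : Prop :=
  exists2 D : set T, countable D & dense D.

Definition is_metric (R : realType) (T : Type) (d : T -> T -> R) : Prop :=
  [/\ forall x y, 0 <= d x y,
      forall x y, d x y = 0 <-> x = y,
      forall x y, d x y = d y x &
      forall x y z, d x z <= d x y + d y z].

Definition metrizable (R : realType) (T : topologicalType) : Prop :=
  exists2 d : T -> T -> R, is_metric d &
    forall (x : T) (A : set T),
      nbhs x A <-> exists2 e : R, 0 < e & [set y | d x y < e] `<=` A.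

(* [A], coerced to a type, carries the subspace topology. *)
Definition aleph0_monolithic (R : realType) (K : topologicalType) : Prop :=
  forall A : set K, separable A -> metrizable R A.

Section SupNorm.
Variables (R : realType) (T : Type).
Implicit Types f g : T -> R.

Definition sup_norm f : R := sup (range (fun x => `|f x|)).

Definition sup_bounded f : Prop := exists M : R, forall x, `|f x| <= M.

Lemma sup_norm_ge f x : sup_bounded f -> `|f x| <= sup_norm f.
Proof.
by move=> [M fM]; apply: ub_le_sup; [exists M => _ [y _ <-]|exists x].
Qed.

Lemma sup_norm_le f M : 0 <= M -> (forall x, `|f x| <= M) -> sup_norm f <= M.
Proof.
move=> M0 fM; rewrite /sup_norm.
have [->|/set0P ne] := eqVneq (range (fun x => `|f x|)) set0.
  by rewrite sup0.
by apply: ge_sup => // _ [x _ <-].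
Qed.

Lemma sup_norm_ge0 f : sup_bounded f -> 0 <= sup_norm f.
Proof.
move=> fb; have [E|/set0P[_ [x _ _]]] := eqVneq (range (fun x => `|f x|)) set0.
  by rewrite /sup_norm E sup0.
exact: le_trans (sup_norm_ge x fb).
Qed.

Lemma sup_normD f g : sup_bounded f -> sup_bounded g ->
  sup_norm (fun x => f x + g x) <= sup_norm f + sup_norm g.
Proof.
move=> fb gb; apply: sup_norm_le => [|x].
  by rewrite addr_ge0 ?sup_norm_ge0.
by rewrite (le_trans (ler_normD _ _))// lerD// sup_norm_ge.
Qed.

Lemma sup_normZ a f : sup_bounded f ->
  sup_norm (fun x => a * f x) = `|a| * sup_norm f.
Proof.
move=> fb; have afb : sup_bounded (fun x => a * f x).
  by case: fb => M fM; exists (`|a| * M) => x; rewrite normrM ler_wpM2l.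
apply/eqP; rewrite eq_le; apply/andP; split.
  apply: sup_norm_le => [|x]; first by rewrite mulr_ge0 ?sup_norm_ge0.
  by rewrite normrM ler_wpM2l// sup_norm_ge.
have [->|a0] := eqVneq a 0.
  by rewrite normr0 mul0r; apply: sup_norm_ge0; exists 0 => x; rewrite mul0r normr0.
rewrite -ler_pdivlMl ?normr_gt0//; apply: sup_norm_le => [|x].
  by rewrite mulr_ge0 ?invr_ge0 ?sup_norm_ge0.
by rewrite ler_pdivlMl ?normr_gt0// -normrM (@sup_norm_ge (fun x => a * f x)).
Qed.

Lemma sup_norm_eq0 f : sup_bounded f -> sup_norm f = 0 -> forall x, f x = 0.
Proof.
by move=> fb f0 x; apply/eqP; rewrite -normr_le0 -f0 sup_norm_ge.
Qed.

End SupNorm.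

Lemma sup_norm_complete (R : realType) (T : Type) (V : normedModType R)
    (ev : V -> T -> R) :
  (forall u v x, ev (u - v) x = ev u x - ev v x) ->
  (forall v x, `|ev v x| <= `|v|) ->
  (forall v M, 0 <= M -> (forall x, `|ev v x| <= M) -> `|v| <= M) ->
  (forall g : T -> R,
    (forall e, 0 < e -> exists v, forall x, `|g x - ev v x| <= e) ->
    exists v, ev v = g) ->
  forall F : set_system V, ProperFilter F -> cauchy F -> cvg F.
Proof.
move=> evB ev_le le_ev ev_cl F FF /cauchyP Fc.
have Fcx (x : T) : cvg ((ev ^~ x) @ F).
  apply: R_complete; apply/cauchy_exP => e e0.
  have [u Fu] := Fc e e0; exists (ev u x).
  change (F [set v | ball (ev u x) e (ev v x)]); apply: filterS Fu => v.
  rewrite -!ball_normE /= => uv;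
  by rewrite -evB (le_lt_trans (ev_le _ _)).
pose g x : R := lim ((ev ^~ x) @ F).
have gF e : 0 < e -> \forall v \near F, forall x, `|g x - ev v x| <= e.
  move=> e0; have e4 : 0 < e / 2 / 2 by rewrite !divr_gt0.
  have [u Fu] := Fc _ e4; apply: filterS (Fu) => v; rewrite -ball_normE /= => uv x.
  have gu : `|g x - ev u x| <= e / 2.
    have [w [uw gw]] : exists w, `|u - w| < e / 2 / 2 /\ `|g x - ev w x| < e / 2 / 2.
      near F => w; exists w; split.
        by near: w; apply: filterS Fu => w; rewrite -ball_normE.
      by near: w; have /cvgrPdist_lt := Fcx x; exact.
    rewrite [leRHS]splitr -(subrK (ev w x) (g x)) -addrA.
    rewrite (le_trans (ler_normD _ _))// lerD ?(ltW gw)//.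
    by rewrite -evB (le_trans (ev_le _ _))// distrC ltW.
  rewrite (splitr e) -(subrK (ev u x) (g x)) -addrA.
  rewrite (le_trans (ler_normD _ _))// lerD// -evB (le_trans (ev_le _ _))//.
  by rewrite (le_trans (ltW uv))// ler_pdivrMr// ler_peMr ?ler1n// ltW// divr_gt0.
have [v vg] : exists v, ev v = g.
  apply: ev_cl => e /gF gFe.
  by near F => v; exists v; near: v.
apply/cvg_ex; exists v; apply/cvgrPdist_le => e e0; have := gF _ e0.
apply: filterS => w gw; apply: le_ev => [|x]; first exact: ltW.
by rewrite evB vg.
Unshelve. all: by end_near. Qed.

Section Submodule.
Variables (R : numFieldType) (V : lmodType R) (Y : set V).
Hypothesis Y_sub : submod_closed [in Y].

Definition submod_pred of submod_closed [in Y] : {pred V} := [in Y].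

HB.instance Definition _ :=
  GRing.isSubmodClosed.Build R V (submod_pred Y_sub) Y_sub.

Definition submod : Type := {x : V | x \in submod_pred Y_sub}.

HB.instance Definition _ := [isSub for @sval V _ : submod -> V].
HB.instance Definition _ := [Choice of submod by <:].
HB.instance Definition _ := [SubChoice_isSubLmodule of submod by <:].

End Submodule.

Section NormedSubmodule.
Variables (R : numFieldType) (V : normedModType R) (Y : set V).
Hypothesis Y_sub : submod_closed [in Y].

Let norm (y : submod Y_sub) : R := `|val y|.

Let ler_norm_submodD x y : norm (x + y) <= norm x + norm y.
Proof. by rewrite /norm raddfD ler_normD. Qed.

Let norm_submodZ a x : norm (a *: x) = `|a| * norm x.
Proof. by rewrite /norm linearZ normrZ. Qed.

Let norm_submod_eq0 x : norm x = 0 -> x = 0.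
Proof. by move=> /normr0_eq0 x0; apply: val_inj; rewrite raddf0. Qed.

HB.instance Definition _ := Lmodule_isNormed.Build R (submod Y_sub)
  ler_norm_submodD norm_submodZ norm_submod_eq0.

End NormedSubmodule.

Section C0.
Variable R : realType.

Definition null_sequence : set (nat -> R^o) := [set u | u @ \oo --> (0 : R)].

Lemma null_sequence_submod : submod_closed [in null_sequence].
Proof.
split=> [|a u v /set_mem u0 /set_mem v0]; apply/mem_set; first exact: cvg_cst.
rewrite /null_sequence /= -(addr0 (0 : R)) -[X in _ --> X + _](mulr0 a).
by apply: (@cvgD _ R^o) => //; apply: (@cvgZr _ R^o).
Qed.

Definition c0 : Type := submod null_sequence_submod.

HB.instance Definition _ := GRing.Lmodule.on c0.

Definition c0_seq (u : c0) : nat -> R := val u.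

Lemma c0_cvg (u : c0) : c0_seq u @ \oo --> (0 : R).
Proof. exact: set_mem (valP u). Qed.

Lemma c0_sup_bounded (u : c0) : sup_bounded (c0_seq u).
Proof.
have /cvgP/cvg_seq_bounded := c0_cvg u.
by move=> [M [_ uM]]; exists (M + 1) => n; apply: uM; rewrite ?ltrDl.
Qed.

Let norm (u : c0) : R := sup_norm (c0_seq u).

Let ler_norm_c0D u v : norm (u + v) <= norm u + norm v.
Proof. by apply: sup_normD; exact: c0_sup_bounded. Qed.

Let norm_c0Z a u : norm (a *: u) = `|a| * norm u.
Proof. by apply: sup_normZ; exact: c0_sup_bounded. Qed.

Let norm_c0_eq0 u : norm u = 0 -> u = 0.
Proof.
move=> u0; apply: val_inj; apply/funext => n.
exact: sup_norm_eq0 (c0_sup_bounded u) u0 n.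
Qed.

HB.instance Definition _ := Lmodule_isNormed.Build R c0
  ler_norm_c0D norm_c0Z norm_c0_eq0.

Lemma c0_normE (u : c0) : `|u| = sup_norm (c0_seq u).
Proof. by []. Qed.

Lemma c0_complete (F : set_system c0) : ProperFilter F -> cauchy F -> cvg F.
Proof.
apply: (@sup_norm_complete _ _ _ c0_seq) => //.
- by move=> u n; apply: sup_norm_ge; exact: c0_sup_bounded.
- by move=> u M; exact: sup_norm_le.
move=> g gP; suff g0 : (g : nat -> R^o) \in submod_pred null_sequence_submod.
  by exists (Sub (g : nat -> R^o) g0).
apply/mem_set/cvgrPdist_le => e e0.
have [u gu] := gP _ (divr_gt0 e0 (ltr0Sn R 1)).
have /cvgrPdist_le/(_ _ (divr_gt0 e0 (ltr0Sn R 1))) := c0_cvg u.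
apply: filterS => n; rewrite !sub0r !normrN => un.
rewrite -(subrK (c0_seq u n) (g n)) (splitr e) (le_trans (ler_normD _ _))//.
by rewrite lerD.
Qed.

HB.instance Definition _ := Uniform_isComplete.Build c0 c0_complete.

End C0.

Section ContinuousFunctions.
Variables (R : realType) (K : topologicalType).
Hypothesis K_compact : compact [set: K].

(* Compactness of [K] is a phantom argument: it makes the supremum norm finite,
   so the normed space structure is attached to the type [C_space R K_compact]. *)
Definition C_space of compact [set: K] : Type := continuousType K R.

Local Notation CK := (C_space K_compact).

HB.instance Definition _ := Choice.on CK.

Definition C_fun (f : CK) : K -> R := (f : continuousType K R).

Lemma C_fun_continuous (f : CK) : continuous (C_fun f).
Proof. exact: (@cts_fun _ _ (f : continuousType K R)). Qed.

Definition C_of (f : K -> R) (f_cts : continuous f) : CK :=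
  (mkcts f_cts : continuousType K R).

Lemma C_ext (f g : CK) : (forall x, C_fun f x = C_fun g x) -> f = g.
Proof. by move=> fg; apply/continuousEP. Qed.

Let zero_continuous : continuous (fun _ : K => 0 : R).
Proof. by move=> x; exact: cvg_cst. Qed.

Let opp_continuous (f : CK) : continuous (fun x => - C_fun f x).
Proof. by move=> x; apply: cvgN; exact: C_fun_continuous. Qed.

Let add_continuous (f g : CK) : continuous (fun x => C_fun f x + C_fun g x).
Proof. by move=> x; apply: cvgD; exact: C_fun_continuous. Qed.

Let scale_continuous a (f : CK) : continuous (fun x => a * C_fun f x).
Proof. by move=> x; apply: cvgMr; exact: C_fun_continuous. Qed.

Let C0 : CK := C_of zero_continuous.
Let C_opp f : CK := C_of (@opp_continuous f).
Let C_add f g : CK := C_of (@add_continuous f g).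
Let C_scale a f : CK := C_of (@scale_continuous a f).

Let C_addA : associative C_add.
Proof. by move=> f g h; apply: C_ext => x; exact: addrA. Qed.

Let C_addC : commutative C_add.
Proof. by move=> f g; apply: C_ext => x; exact: addrC. Qed.

Let C_add0 : left_id C0 C_add.
Proof. by move=> f; apply: C_ext => x; exact: add0r. Qed.

Let C_addN : left_inverse C0 C_opp C_add.
Proof. by move=> f; apply: C_ext => x; exact: addNr. Qed.

HB.instance Definition _ := GRing.isZmodule.Build CK C_addA C_addC C_add0 C_addN.

Let C_scaleA a b f : C_scale a (C_scale b f) = C_scale (a * b) f.
Proof. by apply: C_ext => x; exact: mulrA. Qed.

Let C_scale1 : left_id 1 C_scale.
Proof. by move=> f; apply: C_ext => x; exact: mul1r. Qed.

Let C_scaleDr : right_distributive C_scale +%R.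
Proof. by move=> a f g; apply: C_ext => x; exact: mulrDr. Qed.

Let C_scaleDl f : {morph C_scale^~ f : a b / a + b}.
Proof. by move=> a b; apply: C_ext => x; exact: mulrDl. Qed.

HB.instance Definition _ :=
  GRing.Zmodule_isLmodule.Build R CK C_scaleA C_scale1 C_scaleDr C_scaleDl.

Lemma C_sup_bounded (f : CK) : sup_bounded (C_fun f).
Proof.
have : compact (C_fun f @` setT).
  apply: continuous_compact => //; apply: continuous_subspaceT.
  exact: C_fun_continuous.
move=> /compact_bounded[M [_ fM]]; exists (M + 1) => x.
by apply: fM; [rewrite ltrDl|exists x].
Qed.

Let norm (f : CK) : R := sup_norm (C_fun f).

Let ler_norm_CD f g : norm (f + g) <= norm f + norm g.
Proof. by apply: sup_normD; exact: C_sup_bounded. Qed.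

Let norm_CZ a f : norm (a *: f) = `|a| * norm f.
Proof. by apply: sup_normZ; exact: C_sup_bounded. Qed.

Let norm_C_eq0 f : norm f = 0 -> f = 0.
Proof.
by move=> f0; apply: C_ext; exact: sup_norm_eq0 (C_sup_bounded f) f0.
Qed.

HB.instance Definition _ := Lmodule_isNormed.Build R CK
  ler_norm_CD norm_CZ norm_C_eq0.

Lemma C_normE (f : CK) : `|f| = sup_norm (C_fun f).
Proof. by []. Qed.

Lemma C_complete (F : set_system CK) : ProperFilter F -> cauchy F -> cvg F.
Proof.
apply: (@sup_norm_complete _ _ _ C_fun) => //.
- by move=> f x; apply: sup_norm_ge; exact: C_sup_bounded.
- by move=> f M; exact: sup_norm_le.
move=> g gP; suff g_cts : continuous g by exists (C_of g_cts).
move=> x; apply/cvgrPdist_le => e e0.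
have e3 : 0 < e / 3 by rewrite divr_gt0.
have [f gf] := gP _ e3.
have /cvgrPdist_le/(_ _ e3) := @C_fun_continuous f x.
apply: filterS => y fxy.
rewrite -(subrK (C_fun f x) (g x)) -addrA (le_trans (ler_normD _ _))//.
have -> : e = e / 3 + (e / 3 + e / 3) by field.
rewrite lerD//= -(subrK (C_fun f y) (C_fun f x)) -addrA.
by rewrite (le_trans (ler_normD _ _))// lerD// distrC.
Qed.

HB.instance Definition _ := Uniform_isComplete.Build CK C_complete.

End ContinuousFunctions.

Definition bounded_operator (R : realType) (V W : normedModType R)
    (T : {linear V -> W}) : Prop :=
  exists M : R, forall v, `|T v| <= M * `|v|.

Section C0Extension.
Variables (R : realType) (X : completeNormedModType R).

Definition c0_extension_property_in (Y : set X) (Y_sub : submod_closed [in Y]) :=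
  forall T : {linear submod Y_sub -> c0 R}, bounded_operator T ->
  exists2 S : {linear X -> c0 R}, bounded_operator S &
    forall y : submod Y_sub, S (val y) = T y.

Definition c0_extension_property : Prop :=
  forall (Y : set X) (Y_sub : submod_closed [in Y]),
    closed Y -> c0_extension_property_in Y_sub.

Definition separable_c0_extension_property : Prop :=
  forall (Y : set X) (Y_sub : submod_closed [in Y]),
    closed Y -> separable (submod Y_sub) -> c0_extension_property_in Y_sub.

End C0Extension.

(* Main.v *)
Require Import Defs.
From HB Require Import structures.
From mathcomp Require Import all_boot all_order all_algebra.
From mathcomp Require Import all_classical all_reals all_analysis.
From mathcomp Require Import ring lra zify.
From mathcomp Require finmap.
Import numFieldNormedType.Exports.

Set Implicit Arguments.
Unset Strict Implicit.
Unset Printing Implicit Defensive.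

Import Order.TTheory GRing.Theory Num.Theory.

Local Open Scope classical_set_scope.
Local Open Scope ring_scope.

(* (a) => (b).  Extend the coordinates of an operator [Y -> c0] to functionals
   [Phi_n] on [C(K)].  On a compact line each functional (measure) is carried by
   the closure of a countable set: the complement of a suitable finite set has
   all its convex subsets of small total variation.  So all the [Phi_n] are
   carried by one separable closed [L], which is metrizable by (a), and Veech's
   proof of Sobczyk's theorem applies to the seminorm [sup_L |f|].

   (c) => (a).  Let [L] be the closure of a countable subset [D] of [K].  If [L]
   has countably many jumps (pairs of points with no point of [L] in between)
   then countably many continuous functions separate the points of [L], so [L]
   is metrizable.  Otherwise a dyadic tree of points of [D] gives a monotone
   continuous surjection [pi : K -> [0, 1]] identifying the two ends of each
   jump, with uncountably many values [pi(j)] on jumps.  On the separable space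
   [Y] of functions constant on the fibres of [pi], let [T] list the differences
   of [f] between consecutive points of the dyadic levels.  A function [f] that
   drops from 1 to 0 across a jump [j] is uniformly far from [Y], but for all
   but countably many values of [pi(j)] the measures extending the coordinates
   of [T] have no mass on the fibre of [pi(j)]; thus they treat [f] as an element
   of [Y] dropping from 1 to 0 at [pi(j)], and have infinitely many values close
   to 1 on it. *)

(** * Hahn-Banach theorem *)

Section Scalar.
Variables (R : realType) (V : lmodType R) (f : V -> R).
Hypothesis f_lin : scalar f.

Lemma scalar_mulDr a u v : f (a *: u + v) = a * f u + f v.
Proof. exact: f_lin. Qed.

Lemma scalar_add u v : f (u + v) = f u + f v.
Proof. by rewrite -[u]scale1r scalar_mulDr mul1r scale1r. Qed.

Lemma scalar0 : f 0 = 0.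
Proof. by apply: (addrI (f 0)); rewrite -scalar_add !addr0. Qed.

Lemma scalar_scale a u : f (a *: u) = a * f u.
Proof. by rewrite -[a *: u]addr0 scalar_mulDr scalar0 addr0. Qed.

Lemma scalar_opp u : f (- u) = - f u.
Proof. by rewrite -scaleN1r scalar_scale mulN1r. Qed.

Lemma scalar_sub u v : f (u - v) = f u - f v.
Proof. by rewrite scalar_add scalar_opp. Qed.

End Scalar.

Section HahnBanach.
Variables (R : realType) (V : lmodType R) (p : V -> R).
Hypothesis pD : forall u v, p (u + v) <= p u + p v.
Hypothesis pZ : forall a u, 0 <= a -> p (a *: u) = a * p u.

(* Graphs of linear functionals on subspaces, dominated by [p]; domination
   makes such a subspace of [V * R] single-valued. *)
Definition dominated_graph (G : set (V * R)) :=
  [/\ G (0, 0), forall a u r v s, G (u, r) -> G (v, s) ->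
      G (a *: u + v, a * r + s) & forall u r, G (u, r) -> r <= p u].

Let p0 : p 0 = 0.
Proof. by have := pZ (0 : V) (lexx 0); rewrite scale0r mul0r. Qed.

(** Subtracting the two pairs puts [(0, r - s)] and [(0, s - r)] in [G], and domination bounds both
    values by [p 0 = 0]. *)
Lemma dominated_graph_fun G u r s : dominated_graph G ->
  G (u, r) -> G (u, s) -> r = s.
Proof.
move=> [_ GD Gp] Gr Gs.
have := GD (-1) _ _ _ _ Gr Gs; have := GD (-1) _ _ _ _ Gs Gr.
rewrite !scaleN1r !addNr !mulN1r => /Gp + /Gp; rewrite p0; lra.
Qed.

(** The value [c] at [x] must lie above every [r - p (u - x)] and below every [p (u + x) - r].
    Subadditivity separates the two families, and [c] is the supremum of the first. *)
Lemma dominated_graph_extend G x : dominated_graph G ->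
  exists2 G', dominated_graph G' & G `<=` G' /\ exists c, G' (x, c).
Proof.
move=> [G0 GD Gp].
have Gadd u r v s : G (u, r) -> G (v, s) -> G (u + v, r + s).
  by move=> Gu Gv; have := GD 1 _ _ _ _ Gu Gv; rewrite scale1r mul1r.
have Gscale a u r : G (u, r) -> G (a *: u, a * r).
  by move=> Gu; have := GD a _ _ _ _ Gu G0; rewrite !addr0.
pose A := [set c | exists u r, G (u, r) /\ c = r - p (u - x)].
have A_le u r : G (u, r) -> forall c, A c -> c <= p (u + x) - r.
  move=> Gu c [v [s [Gv ->]]].
  have := Gp _ _ (Gadd _ _ _ _ Gu Gv); have := pD (u + x) (v - x).
  by rewrite addrACA subrr addr0; lra.
have A_ne : A !=set0 by exists (0 - p (0 - x)), 0, 0.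
have A_ub : has_ubound A by exists (p (0 + x) - 0) => c; exact: A_le.
pose c := sup A.
have c_ge u r : G (u, r) -> r - p (u - x) <= c.
  by move=> Gu; apply: ub_le_sup => //; exists u, r.
have c_le u r : G (u, r) -> c <= p (u + x) - r.
  by move=> Gu; apply: ge_sup => //; exact: A_le.
exists [set w | exists u r a, G (u, r) /\ w = (u + a *: x, r + a * c)]; last first.
  split=> [[u r] Gu|]; first by exists u, r, 0; rewrite scale0r mul0r !addr0.
  by exists c, 0, 0, 1; rewrite scale1r mul1r !add0r.
split.
- by exists 0, 0, 0; rewrite scale0r mul0r !addr0.
- move=> a _ _ _ _ [u [r [b [Gu [-> ->]]]]] [v [s [e [Gv [-> ->]]]]].
  exists (a *: u + v), (a * r + s), (a * b + e); split; first exact: GD.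
  congr (_, _); last by ring.
  by rewrite scalerDr scalerA addrACA -scalerDl.
move=> _ _ [u [r [a [Gu [-> ->]]]]].
(* After division by [|a|], domination at [u + a *: x] is the lower bound on [c] if [a < 0] and the
   upper bound if [a > 0]. *)
have [a0|a0|->] := ltgtP a 0; last by rewrite scale0r mul0r !addr0; exact: Gp.
- have na0 : 0 < - a by rewrite oppr_gt0.
  have := c_ge _ _ (Gscale (- a)^-1 _ _ Gu).
  have -> : u + a *: x = (- a) *: ((- a)^-1 *: u - x).
    by rewrite scalerBr scalerA divff ?gt_eqF// scale1r scaleNr opprK.
  rewrite pZ ?(ltW na0)//.
  set q := p _; set r' := _ * r => h.
  have rE : r = - a * r' by rewrite mulrA divff ?gt_eqF// mul1r.
  suff : - a * (r' - q) <= - a * c by rewrite rE; lra.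
  by apply: ler_wpM2l => //; exact: ltW.
- have := c_le _ _ (Gscale a^-1 _ _ Gu).
  have -> : u + a *: x = a *: (a^-1 *: u + x).
    by rewrite scalerDr scalerA divff ?gt_eqF// scale1r.
  rewrite pZ ?(ltW a0)//.
  set q := p _; set r' := _ * r => h.
  have rE : r = a * r' by rewrite mulrA divff ?gt_eqF// mul1r.
  suff : a * c <= a * (q - r') by rewrite rE; lra.
  by apply: ler_wpM2l => //; exact: ltW.
Qed.

Lemma hahn_banach G : dominated_graph G ->
  exists2 F : V -> R, scalar F &
    (forall u, F u <= p u) /\ forall u r, G (u, r) -> F u = r.
Proof.
move=> Gdom.
pose P := [set H | H = set0 \/ dominated_graph H /\ G `<=` H].
have [C CP Ctot|H [PH Hmax]] := @Zorn_bigcup _ P.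
  have [C0|/existsNP[H0 /not_implyP[CH0 H0n]]] := pselect (forall H, C H -> H = set0).
    by left; apply/seteqP; split => // x [H /C0->].
  have {H0n} [H0dom GH0] : dominated_graph H0 /\ G `<=` H0.
    by case: (CP _ CH0) => [/H0n|].
  right; split; last by move=> x /GH0 ?; exists H0.
  split; first by exists H0 => //; case: H0dom.
  - move=> a u r v s [H1 CH1 H1u] [H2 CH2 H2v].
    have [H12|H21] := Ctot _ _ CH1 CH2.
      exists H2 => //; case: (CP _ CH2) => [H20|[[_ HD _] _]].
        by move: H2v; rewrite H20.
      by apply: HD => //; exact: H12.
    exists H1 => //; case: (CP _ CH1) => [H10|[[_ HD _] _]].
      by move: H1u; rewrite H10.
    by apply: HD => //; exact: H21.
  - move=> u r [H1 CH1 H1u]; case: (CP _ CH1) => [H10|[[_ _]]].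
      by move: H1u; rewrite H10.
    by move=> + _; exact.
have {PH} [Hdom GH] : dominated_graph H /\ G `<=` H.
  case: PH => // H0; exfalso; apply: (Hmax G); last by right; split.
  rewrite H0; split => // G0.
  by case: Gdom => /G0.
have Htot x : exists c, H (x, c).
  have [H' H'dom [HH' [c H'c]]] := dominated_graph_extend x Hdom.
  exists c; apply: contrapT => nHc; apply: (Hmax H'); last first.
    by right; split => //; exact: subset_trans HH'.
  by split => // H'H; apply: nHc; exact: H'H.
have [F FP] := choice Htot.
exists F; first move=> a u v.
  apply: (dominated_graph_fun Hdom (FP _)).
  by case: Hdom => _ HD _; exact: HD.
split=> [u|u r Gur]; first by case: Hdom => _ _; apply.
by apply: (dominated_graph_fun Hdom (FP _)); exact: GH.
Qed.

End HahnBanach.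

(** Compactness in its near-covering form, applied to the filter of finite lists of points of [A]
    directed by inclusion. *)
Lemma compact_list_cover (T : topologicalType) (A : set T) (U : T -> set T) :
  compact A -> (forall x, A x -> nbhs x (U x)) ->
  exists2 s : seq T, (forall x, x \in s -> A x) &
    forall y, A y -> exists2 x, x \in s & U x y.
Proof.
move=> /compact_near_coveringP cA nU.
pose F := filter_from [set s : seq T | forall x, x \in s -> A x]
  (fun s => [set s' : seq T | (forall x, x \in s' -> A x) /\ {subset s <= s'}]).
have FF : Filter F.
  apply: filter_from_filter; first by exists [::].
  move=> s t sA tA; exists (s ++ t) => [x|s' [s'A sub]].
    by rewrite mem_cat => /orP[/sA|/tA].
  by split; split => // x xs; apply: sub; rewrite mem_cat xs ?orbT.
have [|s sA] := cA _ F (fun (s : seq T) (x : T) => exists2 z, z \in s & U z x) FF.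
  move=> x Ax.
  exists (U x, [set s : seq T | (forall x, x \in s -> A x) /\ {subset [:: x] <= s}]).
    split; [exact: nU|exists [:: x] => // y].
    by rewrite inE => /eqP->.
  by move=> [y s] /= [Uxy [_ sub]]; exists x => //; apply: sub; rewrite inE.
by move=> sP; exists s => // y Ay; apply: (sP s) => //; split.
Qed.

(** * Sobczyk's theorem *)

(** The [B i] act as a countable base on [L]. For each finite list of pairs (basic set, rational)
    and each precision, one element of [Y] matching them is kept if there is any; by compactness
    every [f] in [Y] matches a list whose basic sets cover [L]. *)
Lemma countable_dense_family (R : realType) (T : topologicalType) (V : Type)
    (ev : V -> T -> R) (L : set T) (B : nat -> set T) (Y : set V) :
  compact L -> Y !=set0 ->
  (forall f x e, Y f -> L x -> 0 < e ->
    exists2 i, nbhs x [set y | L y -> B i y] &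
      forall y, L y -> B i y -> `|ev f y - ev f x| <= e) ->
  exists2 fs : nat -> V, (forall n, Y (fs n)) &
    forall f e, Y f -> 0 < e ->
      exists n, forall x, L x -> `|ev f x - ev (fs n) x| <= e.
Proof.
move=> cL [f0 Yf0] YB.
pose realizes f (s : seq (nat * rat)) k := forall x, L x ->
  forall c, c \in s -> B c.1 x -> `|ev f x - ratr c.2| <= k.+1%:R^-1.
have H (d : seq (nat * rat) * nat) : exists v, Y v /\
    forall f, Y f -> realizes f d.1 d.2 -> realizes v d.1 d.2.
  have [[f [Yf fsk]]|no] := pselect (exists f, Y f /\ realizes f d.1 d.2).
    by exists f.
  by exists f0; split => // f Yf fsk; exfalso; apply: no; exists f.
have {H} [g gP] := choice H.
exists (fun n => if unpickle n is Some d then g d else f0).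
  by move=> n; case: unpickle => // d; case: (gP d).
move=> f e Yf e0.
(* At each point [f] and the kept element will both be within [1/(k+1)] of the same rational. *)
have [k ke] : exists k, k.+1%:R^-1 < e / 2.
  have [k _ kP] := near_infty_natSinv_lt (PosNum (divr_gt0 e0 (ltr0Sn R 1))).
  by exists k; apply: (kP k) => /=.
pose r : R := k.+1%:R^-1; have r0 : 0 < r by rewrite invr_gt0.
have [c cP] : exists c : T -> nat * rat, forall x, L x ->
    nbhs x [set y | L y -> B (c x).1 y] /\
    forall y, L y -> B (c x).1 y -> `|ev f y - ratr (c x).2| <= r.
  have H x : exists d : nat * rat, L x ->
      nbhs x [set y | L y -> B d.1 y] /\
      forall y, L y -> B d.1 y -> `|ev f y - ratr d.2| <= r.
    have [Lx|nLx] := pselect (L x); last by exists (0%N, 0).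
    have [i Bi osc] := YB f x (r / 2) Yf Lx (divr_gt0 r0 (ltr0Sn R 1)).
    have [|q] := @rat_in_itvoo R (ev f x - r / 2) (ev f x + r / 2).
      by rewrite ltrBlDr -addrA ltrDl -splitr.
    rewrite in_itv/= => qx; exists (i, q) => _; split => //= y Ly By.
    have := osc y Ly By; rewrite !ler_norml; lra.
  by have [c cP] := choice H; exists c.
have [s sL scov] := compact_list_cover cL (fun x Lx => (cP x Lx).1).
exists (pickle ([seq c x | x <- s], k)) => x Lx; rewrite pickleK.
have fs : realizes f [seq c x | x <- s] k.
  by move=> y Ly _ /mapP[z /sL Lz ->] By; apply: (cP z Lz).2.
have := (gP ([seq c x | x <- s], k)).2 f Yf fs x Lx.
have [z zs Bz] := scov x Lx.
move=> /(_ (c z) (map_f c zs) (Bz Lx)) h.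
have := fs x Lx (c z) (map_f c zs) (Bz Lx).
by move: h ke; rewrite /= -/r !ler_norml; lra.
Qed.

Section Sobczyk.
Variables (R : realType) (V : lmodType R) (p : V -> R) (M : R).
Hypothesis M0 : 0 <= M.

Definition dual_ball : set (V -> R) :=
  [set F | scalar F /\ forall x, `|F x| <= M * p x].

(** Weak-* compactness of the dual ball: each [Phi i x] stays in a compact segment, where an
    ultrafilter converges, and linearity passes to the limit. *)
Lemma ultrafilter_limit (I : Type) (G : set_system I) (Phi : I -> V -> R) :
  UltraFilter G -> (forall i, dual_ball (Phi i)) ->
  exists2 Psi, dual_ball Psi & forall x, Phi ^~ x @ G --> Psi x.
Proof.
move=> GU PhiB.
have H x : exists l : R, `|l| <= M * p x /\ Phi ^~ x @ G --> l.
  have cI := @segment_compact R (- (M * p x)) (M * p x).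
  have [|l [lI lcl]] := cI (Phi ^~ x @ G) _.
    by apply: (@filterE _ G) => i; rewrite /= in_itv/= -ler_norml; case: (PhiB i).
  exists l; split; first by move: lI; rewrite /= in_itv/= -ler_norml.
  move=> U Ul; have [//|nU] := in_ultra_setVsetC (Phi ^~ x @^-1` U) GU.
  by have [y [nUy Uy]] := lcl (~` U) U nU Ul.
have [Psi PsiP] := choice H.
exists Psi; last by move=> x; case: (PsiP x).
split=> [a u v|x]; last by case: (PsiP x).
apply: (@cvg_unique _ (@norm_hausdorff _ R^o) (Phi ^~ (a *: u + v) @ G)).
  by case: (PsiP (a *: u + v)).
have -> : Phi ^~ (a *: u + v) = (fun i => a * Phi i u + Phi i v).
  by apply/funext => i; case: (PhiB i) => ->.
apply: (@cvgD _ R^o); last by case: (PsiP v).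
by apply: (@cvgZr _ R^o); case: (PsiP u).
Qed.

Variables (xs : nat -> V) (Y : set V) (Phi : nat -> V -> R).
Hypothesis xs_dense : forall x e, 0 < e -> exists j, p (x - xs j) <= e.
Hypothesis PhiB : forall n, dual_ball (Phi n).
Hypothesis Phi0 : forall y, Y y -> Phi ^~ y @ \oo --> (0 : R).

(** A substitute for a small weak-* distance from [Phi n] to the functionals of the dual ball that
    vanish on [Y]. *)
Let good k n := exists Psi, [/\ dual_ball Psi, forall y, Y y -> Psi y = 0 &
  forall j, (j < k)%N -> `|Phi n (xs j) - Psi (xs j)| < k.+1%:R^-1].

Let good0 n : good 0 n.
Proof.
exists (fun=> 0); split => //; split=> [a u v|x]; first by rewrite mulr0 addr0.
by rewrite normr0 (le_trans _ ((PhiB n).2 x)).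
Qed.

(* Otherwise an ultrafilter containing the bad indices gives a limit functional
   in the dual ball, vanishing on [Y], which is good for some bad index. *)
Let good_near k : \forall n \near \oo, good k n.
Proof.
apply: contrapT => bad.
have FP : ProperFilter (within [set n | ~ good k n] \oo).
  apply: Build_ProperFilter => W; apply: bad.
  have {}W : \forall n \near \oo, ~ good k n -> False := W.
  by apply: filterS W => n; exact: contrapT.
have [G [GU FG]] := ultraFilterLemma FP.
have [Psi PsiB PsiP] := ultrafilter_limit GU PhiB.
have Gbad : G [set n | ~ good k n] by apply: FG; exact: withinT.
have Gclose : G [set n | forall j : 'I_k, `|Phi n (xs j) - Psi (xs j)| < k.+1%:R^-1].
  apply: filter_forall => j; have /cvgrPdist_lt := PsiP (xs j).
  move=> /(_ k.+1%:R^-1); rewrite invr_gt0 ltr0n => /(_ isT).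
  by apply: filterS => n; rewrite distrC.
have [n [nbad nclose]] := filter_ex (filterI Gbad Gclose).
apply: nbad; exists Psi; split=> // [y Yy|j jk]; last exact: (nclose (Ordinal jk)).
apply: (@cvg_unique _ (@norm_hausdorff _ R^o) (Phi ^~ y @ G)); first exact: PsiP.
apply: cvg_trans (Phi0 Yy) => A /= A0.
by apply: FG; exact: (@cvg_within _ \oo).
Qed.

(** [Psi n] witnesses the best level [k n] at which [n] is good. These levels tend to infinity, so
    [Phi n - Psi n] tends to 0 at every [xs j], hence everywhere by the common bound [M * p]. *)
Lemma sobczyk_correction : exists Psi : nat -> V -> R,
  [/\ forall n, dual_ball (Psi n), forall n y, Y y -> Psi n y = 0 &
      forall x, (fun n => Phi n x - Psi n x) @ \oo --> (0 : R)].
Proof.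
(* Levels are capped at [n] so that a largest one exists. *)
have H n : exists k, good k n /\ forall k', (k' <= n)%N -> good k' n -> (k' <= k)%N.
  have [||k /andP[/asboolP gk _] kmax] :=
    @ex_maxnP (fun k => `[< good k n >] && (k <= n)%N) n.
  - by exists 0%N; rewrite leq0n andbT; apply/asboolP.
  - by move=> i /andP[].
  - by exists k; split => // k' k'n gk'; apply: kmax; rewrite k'n andbT; apply/asboolP.
have {H} [k kP] := choice H.
have [Psi PsiP] := choice (fun n => (kP n).1).
exists Psi; split=> [n|n y Yy|x]; [by case: (PsiP n)|by case: (PsiP n) => _ ->|].
apply/cvgrPdist_lt => e e0.
(* With this denominator [Phi n] and [Psi n] each change by at most [e / 4] between [x] and [xs j],
   which leaves [e / 2] for their difference at [xs j]. *)
have M1 : 0 < 4 * (M + 1) by rewrite mulr_gt0// ltr_wpDl.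
have [j xj] := xs_dense x (divr_gt0 e0 M1).
have [N _ NP] := near_infty_natSinv_lt (PosNum (divr_gt0 e0 (ltr0Sn R 1))).
pose m := maxn N j.+1.
near=> n.
have mk : (m <= k n)%N.
  by apply: (kP n).2; near: n; [exact: nbhs_infty_ge|exact: good_near].
have close : `|Phi n (xs j) - Psi n (xs j)| < e / 2.
  case: (PsiP n) => _ _ /(_ j); rewrite (leq_trans _ mk) ?leq_max ?ltnSn ?orbT//.
  move=> /(_ isT)/lt_trans; apply; apply: NP => /=.
  by rewrite (leq_trans _ mk)// leq_max leqnn.
have far (F : V -> R) : dual_ball F -> `|F (x - xs j)| <= e / 4.
  move=> [_ /(_ (x - xs j))]/le_trans; apply.
  apply: le_trans (ler_wpM2l M0 xj) _.
  have -> : M * (e / (4 * (M + 1))) = e / 4 * (M / (M + 1)).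
    by field; rewrite gt_eqF// ltr_wpDl.
  by rewrite ler_piMr ?divr_ge0 ?(ltW e0)// ler_pdivrMr ?ltr_wpDl// mul1r lerDl.
have := far _ (PhiB n); have [PB _ _] := PsiP n; have := far _ PB.
rewrite sub0r normrN (scalar_sub PB.1) (scalar_sub (PhiB n).1).
move: close; rewrite !ltr_norml !ler_norml; lra.
Unshelve. all: by end_near. Qed.

End Sobczyk.

(** * Functionals on a space of continuous functions *)

Section CSpace.
Variables (R : realType) (K : topologicalType) (K_compact : compact [set: K]).
Local Notation CK := (C_space R K_compact).
Implicit Types (f g : CK) (x : K) (c e : R) (U : set K).

Lemma C_funD f g x : C_fun (f + g) x = C_fun f x + C_fun g x.
Proof. by []. Qed.

Lemma C_funB f g x : C_fun (f - g) x = C_fun f x - C_fun g x.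
Proof. by []. Qed.

Lemma C_funZ c f x : C_fun (c *: f) x = c * C_fun f x.
Proof. by []. Qed.

Lemma C_fun_le f x : `|C_fun f x| <= `|f|.
Proof. by apply: sup_norm_ge; exact: C_sup_bounded. Qed.

Lemma C_norm_le f c : 0 <= c -> (forall x, `|C_fun f x| <= c) -> `|f| <= c.
Proof. exact: sup_norm_le. Qed.

Lemma clamp_continuous f c :
  continuous (fun x => Num.max (- c) (Num.min c (C_fun f x))).
Proof.
move=> x; apply: max_fun_continuous; first by move=> ?; exact: cvg_cst.
by apply: min_fun_continuous; [move=> ?; exact: cvg_cst|exact: C_fun_continuous].
Qed.

Definition clamp c f : CK := C_of K_compact (@clamp_continuous f c).

Lemma clampE c f x : C_fun (clamp c f) x = Num.max (- c) (Num.min c (C_fun f x)).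
Proof. by []. Qed.

Lemma clamp_le c f x : 0 <= c -> `|C_fun (clamp c f) x| <= c.
Proof.
move=> c0; rewrite clampE ler_norml le_max lexx ge_max ge_min lexx /= andbT; lra.
Qed.

Lemma clamp_id c f x : `|C_fun f x| <= c -> C_fun (clamp c f) x = C_fun f x.
Proof. by rewrite clampE ler_norml => /andP[? ?]; rewrite min_r// max_r. Qed.

Lemma clamp_sub_le c f x : 0 <= c ->
  `|C_fun f x - C_fun (clamp c f) x| <= `|C_fun f x|.
Proof.
move=> c0; have [/clamp_id->|] := leP `|C_fun f x| c.
  by rewrite subrr normr0.
rewrite ltr_normr clampE => /orP[h|h].
  by rewrite min_l ?(ltW h)// max_r; [rewrite !ger0_norm; lra|lra].
by rewrite min_r ?max_l; [rewrite !ler0_norm; lra|lra|lra].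
Qed.


Section SmallSets.
Variables (Phi : CK -> R) (M : R).
Hypothesis Phi_lin : scalar Phi.
Hypothesis M0 : 0 <= M.
Hypothesis PhiM : forall f, `|Phi f| <= M * `|f|.

(* For the measure [mu] representing [Phi]: the total variation of [mu] on an
   open set [U] is at most [e]. *)
Definition small e U :=
  forall g, (forall x, C_fun g x != 0 -> U x) -> `|Phi g| <= e * `|g|.

Lemma small_subset e U U' : U `<=` U' -> small e U' -> small e U.
Proof. by move=> UU' sU' g gU; apply: sU' => x /gU/UU'. Qed.

Lemma small0 e U : 0 <= e -> (forall x, ~ U x) -> small e U.
Proof.
move=> e0 U0 g gU; have -> : g = 0.
  by apply: C_ext => x; apply/eqP/negPn/negP => /gU/U0.
by rewrite (scalar0 Phi_lin) !normr0 mulr0.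
Qed.

Lemma not_small_bump e U : ~ small e U -> exists2 g, `|g| <= 1 &
  (forall x, C_fun g x != 0 -> U x) /\ e < Phi g.
Proof.
move=> /existsNP[g /not_implyP[gU /negP]]; rewrite -ltNge => ge.
have g0 : 0 < `|g|.
  rewrite lt_neqAle normr_ge0 andbT eq_sym normr_eq0; apply/eqP => g0.
  by move: ge; rewrite g0 (scalar0 Phi_lin) !normr0 mulr0 ltxx.
exists ((Num.sg (Phi g) / `|g|) *: g).
  rewrite normrZ normrM normfV normr_id divfK ?gt_eqF// normr_sg.
  by case: eqP => //= _; rewrite ler01.
split=> [x|].
  by rewrite C_funZ mulf_eq0 negb_or => /andP[_]; exact: gU.
by rewrite (scalar_scale Phi_lin) mulrAC -normrEsg ltr_pdivlMr.
Qed.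

(** Adding one bump for each of the disjoint sets gives a function of norm at most 1 on which [Phi]
    is at least [n * e]. *)
Lemma disjoint_not_small e (U : nat -> set K) n :
  (forall i, (i < n)%N -> ~ small e (U i)) ->
  (forall i j x, (i < j < n)%N -> U i x -> ~ U j x) -> n%:R * e <= M.
Proof.
move=> nU dU.
suff [g [g1 gU gn]] : exists g, [/\ `|g| <= 1,
    (forall x, C_fun g x != 0 -> exists2 i, (i < n)%N & U i x) & n%:R * e <= Phi g].
  apply: (le_trans gn); apply: le_trans (ler_norm _) (le_trans (PhiM g) _).
  by rewrite ler_piMr.
elim: n nU dU => [|n IH] nU dU.
  exists 0; split; rewrite ?normr0 ?(scalar0 Phi_lin) ?mul0r//.
  by move=> x /eqP.
have [i ik|i j x ijk|g [g1 gU gn]] := IH.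
- by apply: nU; rewrite ltnS ltnW.
- by apply: dU; case/andP: ijk => -> /ltnW; rewrite ltnS.
have [h h1 [hU hn]] := not_small_bump (nU n (ltnSn n)).
exists (g + h); split; last first.
- by rewrite (scalar_add Phi_lin) -natr1 mulrDl mul1r lerD// ltW.
- move=> x; rewrite C_funD.
  have [->|/gU[i ik Ui] _] := eqVneq (C_fun g x) 0; last by exists i => //; exact: ltnW.
  by rewrite add0r => /hU ?; exists n.
apply: C_norm_le => // x; rewrite C_funD.
have [->|/gU[i ik Ui]] := eqVneq (C_fun g x) 0.
  by rewrite add0r (le_trans (C_fun_le _ _)).
have [->|/hU Un] := eqVneq (C_fun h x) 0.
  by rewrite addr0 (le_trans (C_fun_le _ _)).
by case: (dU i n x) => //; rewrite ik /=.
Qed.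

(** A function [g] carried by [N] minus [x] vanishes at [x], so it is small near [x]. Removing its
    truncation [clamp n g] makes it vanish near [x] and changes [Phi g] by at most [M * n]. *)
Lemma not_small_shrink e x N : 0 <= e -> nbhs x N -> ~ small e (N `\ x) ->
  exists N', [/\ nbhs x N', N' `<=` N & ~ small e (N `\` N')].
Proof.
move=> e0 Nx /not_small_bump[g g1 [gN eg]].
have M1 : 0 < 2 * (M + 1) by rewrite mulr_gt0// ltr_wpDl.
(* Chosen so that [M * n] is less than [Phi g - e]. *)
pose n := (Phi g - e) / (2 * (M + 1)).
have n0 : 0 < n by rewrite divr_gt0// subr_gt0.
have gx : C_fun g x = 0 by apply/eqP/negPn/negP => /gN[_]; apply.
exists (N `&` [set y | `|C_fun g y| < n]); split.
- apply: filterI => //; have /cvgrPdist_lt/(_ n n0) := @C_fun_continuous _ _ _ g x.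
  by apply: filterS => y; rewrite gx sub0r normrN.
- exact: subIsetl.
move=> sN; have : `|Phi (g - clamp n g)| <= e.
  apply: (le_trans (sN _ _)).
    move=> y; rewrite C_funB => gny.
    have ny : n < `|C_fun g y|.
      by rewrite ltNge; apply/negP => /clamp_id h; move: gny; rewrite h subrr eqxx.
    split; last by move=> [_ /=]; rewrite ltNge (ltW ny).
    by have [] : (N `\ x) y by apply: gN; rewrite -normr_gt0 (lt_trans n0).
  rewrite ler_piMr// C_norm_le// => y; rewrite C_funB.
  by rewrite (le_trans _ (le_trans (C_fun_le g y) g1))// clamp_sub_le// ltW.
have : `|Phi (clamp n g)| <= M * n.
  apply: le_trans (PhiM _) _; apply: ler_wpM2l => //.
  by apply: C_norm_le => [|y]; [exact: ltW|exact/clamp_le/ltW].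
rewrite (scalar_sub Phi_lin).
have : n * (2 * (M + 1)) = Phi g - e by rewrite divfK// gt_eqF.
have : 0 <= M * n by rewrite mulr_ge0// ltW.
by rewrite !ler_norml; lra.
Qed.

(** Otherwise shrinking can be iterated and yields arbitrarily many disjoint rings around [x] that
    are not small. *)
Lemma small_punctured_nbhs e x : 0 < e -> exists2 N, nbhs x N & small e (N `\ x).
Proof.
move=> e0; apply: contrapT => no.
have H N : exists N', nbhs x N -> [/\ nbhs x N', N' `<=` N & ~ small e (N `\` N')].
  have [Nx|//] := pselect (nbhs x N); last by exists N.
  have [|N' ?] := not_small_shrink (ltW e0) Nx; last by exists N'.
  by move=> sN; apply: no; exists N.
have {H} [next nextP] := choice H.
pose N i := iter i next setT.
have Nx i : nbhs x (N i).
  by elim: i => [|i /nextP[]//]; exact: filterT.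
have N_sub i j y : (i <= j)%N -> N j y -> N i y.
  elim: j => [|j IH]; first by rewrite leqn0 => /eqP->.
  rewrite leq_eqVlt => /orP[/eqP->//|]; rewrite ltnS => ij.
  by have [_ sub _] := nextP _ (Nx j) => /sub; exact: IH.
have dU i j y n : (i < j < n)%N -> (N i `\` N i.+1) y -> ~ (N j `\` N j.+1) y.
  by move=> /andP[ij _] [_ nNi] [/(N_sub _ _ _ ij)].
have nU i : ~ small e (N i `\` N i.+1) by case: (nextP _ (Nx i)).
have [n ne] : exists n : nat, M < n%:R * e.
  exists (Num.bound (M / e)).
  by rewrite -ltr_pdivrMr// archi_boundP// divr_ge0// ltW.
have := @disjoint_not_small e (fun i => N i `\` N i.+1) n (fun i _ => nU i)
  (fun i j y => @dU i j y n).
by rewrite leNgt ne.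
Qed.

End SmallSets.
End CSpace.

(** * Functionals on compact lines *)

Section CompactLine.
Variables (R : realType) (d : Order.disp_t) (K : orderTopologicalType d).
Variable K_compact : compact [set: K].
Local Notation CK := (C_space R K_compact).
Implicit Types (f g : CK) (x y z : K) (c e : R) (C U : set K).

Definition convex C := forall x y z, C x -> C y -> (x <= z <= y)%O -> C z.

(** If a convex set meets [I] and also leaves it, convexity puts an endpoint of [I] in that set. *)
Lemma itv_endpoints (I : interval K) : exists s : seq K, forall C y,
  convex C -> (forall x, x \in s -> ~ C x) -> C y -> y \in I -> C `<=` [set` I].
Proof.
case: I => [l r].
exists ((if l is BSide _ a then [:: a] else [::]) ++
        (if r is BSide _ a then [:: a] else [::])).
move=> C y Cc Cs Cy yI z Cz; move: yI; rewrite /= !itv_boundlr => /andP[ly yr].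
have lz : (l <= BLeft z)%O.
  case: l ly Cs => [b a|[]//] ly Cs; rewrite leNgt; apply/negP => zl.
  apply: (Cs a); first by rewrite mem_cat inE eqxx.
  apply: (Cc z y) => //; move: ly zl; case: b; rewrite !bnd_simp => h1 h2.
  - by rewrite h1 (ltW h2).
  - by rewrite (ltW h1) h2.
rewrite lz /=.
case: r yr Cs => [b a|[]//] yr Cs; rewrite leNgt; apply/negP => zl.
apply: (Cs a); first by rewrite mem_cat inE eqxx orbT.
apply: (Cc y z) => //; move: yr zl; case: b; rewrite !bnd_simp => h1 h2.
- by rewrite (ltW h1) h2.
- by rewrite h1 (ltW h2).
Qed.

Lemma itv_convex (I : interval K) : convex [set` I].
Proof.
case: I => l r x y z; rewrite /= !itv_boundlr => /andP[lx _] /andP[_ yr].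
by move=> /andP[xz zy]; rewrite (le_trans lx) ?(le_trans _ yr)// bnd_simp.
Qed.

Section Support.
Variables (Phi : CK -> R) (M : R).
Hypothesis Phi_lin : scalar Phi.
Hypothesis M0 : 0 <= M.
Hypothesis PhiM : forall f, `|Phi f| <= M * `|f|.

(** Finitely many intervals [I x], each small apart from its centre [x], cover [K]. The list [s]
    holds their centres and endpoints, so a nonempty convex set missing [s] lies in one of them and
    avoids its centre. *)
Lemma small_gaps e : 0 < e -> exists s : seq K, forall C,
  convex C -> (forall x, x \in s -> ~ C x) -> small Phi e C.
Proof.
move=> e0.
have H x : exists I : interval K, nbhs x [set` I] /\ small Phi e ([set` I] `\ x).
  have [N + sN] := small_punctured_nbhs Phi_lin M0 PhiM x e0.
  rewrite itv_nbhsE => -[I [Io xI] IN]; exists I; split.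
    by exists I.
  by apply: small_subset sN; exact: setSD.
have {H} [I IP] := choice H.
have [xs _ xscov] := compact_list_cover K_compact (fun x _ => (IP x).1).
have [E EP] := choice (fun x => itv_endpoints (I x)).
exists (xs ++ flatten [seq E x | x <- xs]) => C Cc Cs.
have [[y Cy]|no] := pselect (exists y, C y); last first.
  by apply: small0 => //; [exact: ltW|move=> x Cx; apply: no; exists x].
have [x xxs Iy] := xscov y Logic.I.
apply: small_subset (IP x).2 => z Cz; split; last first.
  by move=> /= zx; apply: (Cs x); rewrite -?zx// mem_cat zx xxs.
apply: (EP x C y) => // w wE; apply: Cs; rewrite mem_cat; apply/orP; right.
by apply/flattenP; exists (E x) => //; exact: map_f.
Qed.

Lemma null_gaps : exists2 D : set K, countable D & forall C f,
  convex C -> (forall x, D x -> ~ C x) -> (forall x, C_fun f x != 0 -> C x) ->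
  Phi f = 0.
Proof.
have H (k : nat) := @small_gaps k.+1%:R^-1 ltac:(by rewrite invr_gt0).
have [s sP] := choice H.
exists (\bigcup_k [set` s k]).
  by apply: bigcup_countable => // k _; exact/finite_set_countable/finite_seq.
move=> C f Cc CD fC; apply/eqP; rewrite -normr_le0 leNgt; apply/negP => f0.
have fgt0 : 0 < `|f|.
  rewrite lt_neqAle normr_ge0 andbT eq_sym normr_eq0; apply/eqP => fE.
  by move: f0; rewrite fE (scalar0 Phi_lin) normr0 ltxx.
have [k _ kP] := near_infty_natSinv_lt (PosNum (divr_gt0 f0 fgt0)).
have := kP k (leqnn k); rewrite /= ltr_pdivlMr// ltNge => /negP; apply.
by apply: (sP k) fC => // x xs; apply: CD; exists k.
Qed.

(* The convex component of [x] in [{f <> 0}]: it is clopen in [{f <> 0}], so [f]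
   can be replaced by [0] on it without leaving [C(K)]. *)
Definition component f x : set K :=
  [set y | forall z, ((x <= z <= y) || (y <= z <= x))%O -> C_fun f z != 0].

Lemma component_convex f x : convex (component f x).
Proof.
move=> y y' z xy xy' /andP[yz zy'] w; have [xz|zx] := leP x z.
  move=> /orP[/andP[xw wz]|/andP[zw wx]].
    by apply: xy'; rewrite xw (le_trans wz zy').
  have -> : w = x by apply/eqP; rewrite eq_le wx (le_trans xz zw).
  by apply: xy; rewrite lexx; case: leP => //= /ltW->.
move=> /orP[/andP[xw wz]|/andP[zw wx]].
  by have := lt_le_trans zx (le_trans xw wz); rewrite ltxx.
by apply: xy; rewrite (le_trans yz zw) wx orbT.
Qed.

Lemma component_sym f x y : component f x y -> component f y x.
Proof. by move=> xy z; rewrite orbC; exact: xy. Qed.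

Lemma component_trans f x y z :
  component f x y -> component f y z -> component f x z.
Proof.
move=> xy yz w; have [wy|yw] := leP w y.
  move=> /orP[/andP[xw wz]|/andP[zw wx]].
    by apply: xy; rewrite xw wy.
  by apply: yz; rewrite wy zw orbT.
move=> /orP[/andP[xw wz]|/andP[zw wx]].
  by apply: yz; rewrite (ltW yw) wz.
by apply: xy; rewrite (ltW yw) wx orbT.
Qed.

Lemma component_nbhs f x : C_fun f x != 0 -> nbhs x (component f x).
Proof.
move=> fx; have : nbhs x [set y | C_fun f y != 0].
  apply: (@C_fun_continuous _ _ _ f x [set t | t != 0]).
  by apply: open_nbhs_nbhs; split => //; exact: open_neq.
rewrite itv_nbhsE => -[I [Io xI] If].
exists I => // y yI z /orP[h|h]; apply: If.
  exact: itv_convex h.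
exact: itv_convex h.
Qed.

Lemma component_ne0 f x y : component f x y -> C_fun f y != 0.
Proof. by apply; case: leP; rewrite lexx//= => /ltW. Qed.

Definition erase f (s : seq K) (y : K) : R :=
  if `[< exists2 x, x \in s & component f x y >] then 0 else C_fun f y.

Lemma erase_le f s y : `|erase f s y| <= `|C_fun f y|.
Proof. by rewrite /erase; case: asboolP => _; rewrite ?normr0. Qed.

(** Near a point with [f y != 0], being erased or not is locally constant; at a zero of [f] the
    bound [erase_le] suffices. *)
Lemma erase_continuous f s : continuous (erase f s).
Proof.
move=> y; rewrite /continuous_at; have [fy|fy] := eqVneq (C_fun f y) 0.
  have -> : erase f s y = 0.
    by apply/eqP; rewrite -normr_le0; have := erase_le f s y; rewrite fy normr0.
  apply/cvgrPdist_lt => e e0; have /cvgrPdist_lt/(_ e e0) := @C_fun_continuous _ _ _ f y.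
  apply: filterS => z; rewrite fy !sub0r !normrN.
  exact/le_lt_trans/erase_le.
have near_eq z : component f y z -> (exists2 x, x \in s & component f x z) <->
    (exists2 x, x \in s & component f x y).
  move=> yz; split=> -[x xs xz]; exists x => //.
    exact: component_trans xz (component_sym yz).
  exact: component_trans xz yz.
have [ex|nex] := pselect (exists2 x, x \in s & component f x y).
  have -> : erase f s y = 0 by rewrite /erase asboolT.
  apply/cvgrPdist_lt => e e0; apply: filterS (component_nbhs fy) => z /near_eq h.
  by rewrite /erase asboolT ?subrr ?normr0//; apply/h.
have -> : erase f s y = C_fun f y by rewrite /erase asboolF.
apply/cvgrPdist_lt => e e0; have /cvgrPdist_lt/(_ e e0) := @C_fun_continuous _ _ _ f y.
apply: filterS2 (component_nbhs fy) => z /near_eq h.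
by rewrite /erase asboolF// => /h.
Qed.

Definition C_erase f s : CK := C_of K_compact (@erase_continuous f s).

Lemma C_eraseE f s y : C_fun (C_erase f s) y = erase f s y.
Proof. by []. Qed.

(** The measure of [Phi] is carried by the closure of [D]. If [f] vanishes on [D], each component of
    [{f <> 0}] is convex and misses [D], so erasing it keeps [Phi f]; by compactness finitely many
    erasures make the norm arbitrarily small. *)
Lemma separable_support : exists2 D : set K, countable D &
  forall f c, 0 <= c -> (forall x, D x -> `|C_fun f x| <= c) -> `|Phi f| <= M * c.
Proof.
have [D Dc DP] := null_gaps; exists D => //.
have null f : (forall x, D x -> C_fun f x = 0) -> Phi f = 0.
  move=> fD.
  have eraseE s : Phi (C_erase f s) = Phi f.
    elim: s => [|x s <-].
      congr Phi; apply: C_ext => x.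
      by rewrite C_eraseE /erase asboolF// => -[].
    apply/eqP; rewrite -subr_eq0 -(scalar_sub Phi_lin); apply/eqP.
    apply: (DP (component f x)); first exact: component_convex.
      by move=> y /fD fy /component_ne0; rewrite fy eqxx.
    move=> y; rewrite C_funB.
    apply: contraNP => nxy; rewrite subr_eq0; apply/eqP.
    rewrite !C_eraseE /erase; congr (if _ then _ else _).
    apply: asbool_equiv_eq; split=> -[z zs zy]; last first.
      by exists z => //; rewrite inE zs orbT.
    by move: zs; rewrite inE => /orP[/eqP zx|zs]; [rewrite -zx in nxy|exists z].
  apply/eqP; rewrite -normr_le0; apply/ler_addgt0Pl => e e0; rewrite addr0.
  have e1 : 0 < e / (M + 1) by rewrite divr_gt0// ltr_wpDl.
  have nU x : nbhs x [set y | component f x y \/ `|C_fun f y| < e / (M + 1)].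
    have [fx|fx] := eqVneq (C_fun f x) 0; last first.
      by apply: filterS (component_nbhs fx) => y; left.
    have /cvgrPdist_lt/(_ _ e1) := @C_fun_continuous _ _ _ f x.
    by apply: filterS => y; rewrite fx sub0r normrN; right.
  have [s _ scov] := compact_list_cover K_compact (fun x _ => nU x).
  rewrite -(eraseE s); apply: le_trans (PhiM _) _.
  apply: (@le_trans _ _ (M * (e / (M + 1)))).
    apply: ler_wpM2l => //; apply: C_norm_le => [|y]; first exact: ltW.
    have [x xs [xy|fy]] := scov y Logic.I; last first.
      exact: le_trans (erase_le f s y) (ltW fy).
    by rewrite C_eraseE /erase asboolT ?normr0 ?ltW//; exists x.
  by rewrite mulrCA ler_piMr ?(ltW e0)// ler_pdivrMr ?ltr_wpDl// mul1r lerDl.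
move=> f c c0 fD.
(* [f] agrees on [D] with its truncation, whose norm is at most [c]. *)
have -> : Phi f = Phi (clamp c f).
  apply/eqP; rewrite -subr_eq0 -(scalar_sub Phi_lin); apply/eqP/null => x /fD.
  by move=> /clamp_id h; rewrite C_funB h subrr.
apply: le_trans (PhiM _) _; apply: ler_wpM2l => //.
by apply: C_norm_le => // x; exact: clamp_le.
Qed.

End Support.
End CompactLine.

(** * Extension of operators over monolithic compact lines *)

Lemma countable_enum (T : Type) (D : set T) : countable D -> D !=set0 ->
  exists e : nat -> T, forall x, D x <-> exists n, e n = x.
Proof.
move=> /pfcard_geP[->|/unsquash e] D0; first by have [x []] := D0.
exists e => x; split=> [/(@surj _ _ _ _ e)[n _ <-]|[n <-]]; first by exists n.
exact: funS.
Qed.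

Lemma nbhs_set_type (T : topologicalType) (A : set T) (x : A) (U : set A) :
  nbhs x U <-> nbhs (set_val x) [set y | forall z : A, set_val z = y -> U z].
Proof.
split.
  case=> _ /= [] [W oW <- /= Wx sWU].
  apply: filterS (open_nbhs_nbhs (conj oW Wx)) => y Wy z zy.
  by apply: sWU => /=; rewrite zy.
rewrite nbhsE => -[W [oW Wx] WU].
exists (set_val @^-1` W); split => //=; first by exists W.
by move=> z /WU; apply.
Qed.

Section C0Operator.
Variables (R : realType) (X : normedModType R) (Phi : nat -> X -> R).
Hypothesis Phi_lin : forall n, scalar (Phi n).
Hypothesis Phi_null : forall x, Phi ^~ x @ \oo --> (0 : R).

Let null_mem x : (Phi ^~ x : nat -> R^o) \in submod_pred (null_sequence_submod R).
Proof. exact/mem_set/Phi_null. Qed.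

Let op (x : X) : c0 R := Sub (Phi ^~ x : nat -> R^o) (null_mem x).

Let op_linear : linear op.
Proof.
move=> a u v; apply: val_inj; rewrite linearP !SubK; apply/funext => n.
by rewrite Phi_lin.
Qed.

Lemma c0_operator : exists S : {linear X -> c0 R},
  forall x n, c0_seq (S x) n = Phi n x.
Proof.
pose S : {linear X -> c0 R} := HB.pack op (GRing.isLinear.Build R X (c0 R) _ op op_linear).
by exists S.
Qed.

End C0Operator.

Lemma c0_ext (R : realType) (u v : c0 R) : (forall n, c0_seq u n = c0_seq v n) -> u = v.
Proof. by move=> uv; apply: val_inj; apply/funext => n; exact: uv. Qed.

Lemma c0_seqP (R : realType) (X : lmodType R) (T : {linear X -> c0 R}) n :
  scalar (fun x => c0_seq (T x) n).
Proof. by move=> a u v; rewrite linearP. Qed.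

Lemma c0_seq_le (R : realType) (u : c0 R) n : `|c0_seq u n| <= `|u|.
Proof. by apply: sup_norm_ge; exact: c0_sup_bounded. Qed.

Lemma bounded_operator_ge0 (R : realType) (V W : normedModType R) (T : {linear V -> W}) :
  bounded_operator T -> exists2 M : R, 0 <= M & forall v, `|T v| <= M * `|v|.
Proof.
move=> [M TM]; exists `|M| => // v; apply: le_trans (TM v) _.
by rewrite ler_wpM2r// ler_norm.
Qed.

Section MonolithicExtension.
Variables (R : realType) (d : Order.disp_t) (K : orderTopologicalType d).
Variable K_compact : compact [set: K].
Local Notation CK := (C_space R K_compact).

Lemma metrizable_closure_base (D : set K) : countable D ->
  metrizable R (closure D) ->
  exists B : nat -> set K, forall (f : CK) x e, closure D x -> 0 < e ->
    exists2 i, nbhs x [set y | closure D y -> B i y] &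
      forall y, closure D y -> B i y -> `|C_fun f y - C_fun f x| <= e.
Proof.
move=> Dc [dist [d_ge0 d0 dC dT] distP].
have [D0|/set0P Dn0] := eqVneq D set0.
  by exists (fun=> set0) => f x e; rewrite D0 closure0.
have [q qP] := countable_enum Dc Dn0.
have qD n : D (q n) by apply/qP; exists n.
pose b n : closure D := SigSub (mem_set (subset_closure (qD n))).
(* The code of [(n, k)] stands for the ball of radius [1/(k+1)] about the point [b n] of [D]; points
   outside [closure D] belong to it vacuously. *)
exists (fun i => if unpickle i is Some (n, k) then
  [set y | forall z : closure D, set_val z = y -> dist (b n) z < (k : nat).+1%:R^-1] else set0).
move=> f x e Lx e0; pose x' : closure D := SigSub (mem_set Lx).
have [r r0 rP] : exists2 r, 0 < r & forall z, dist x' z < r ->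
    `|C_fun f (set_val z) - C_fun f x| <= e.
  apply: (distP x' [set z | `|C_fun f (set_val z) - C_fun f x| <= e]).1.
  apply/nbhs_set_type.
  have /cvgrPdist_le/(_ e e0) := @C_fun_continuous _ _ _ f x.
  by apply: filterS => y; rewrite distrC => h z zy /=; rewrite zy.
(* Half of [r], so that a ball of radius [s] about [b n] that contains [x] stays within distance [r]
   of [x]. *)
have [k _ /(_ k (leqnn k))/= kr] := near_infty_natSinv_lt (PosNum (divr_gt0 r0 (ltr0Sn R 1))).
pose s : R := k.+1%:R^-1; have s0 : 0 < s by rewrite invr_gt0.
have [n bn] : exists n, dist x' (b n) < s.
  have : nbhs x' [set z | dist x' z < s] by apply/distP; exists s.
  move=> /nbhs_set_type /(Lx _)[y [/qP[n qn] yP]].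
  by exists n; apply: yP.
exists (pickle (n, k)); rewrite pickleK; last first.
  move=> y Ly /(_ (SigSub (mem_set Ly)) erefl) bz.
  apply: (rP (SigSub (mem_set Ly))).
  apply: le_lt_trans (dT _ (b n) _) _; move: bn bz kr; rewrite -/s; lra.
have : nbhs x' [set z | dist x' z < s - dist x' (b n)].
  by apply/distP; exists (s - dist x' (b n)) => //; rewrite subr_gt0.
move=> /nbhs_set_type; apply: filterS => y yP Ly z zy.
have /= := yP z zy.
rewrite ltrBrDr => h; apply: le_lt_trans (dT _ x' _) _.
by rewrite dC addrC.
Qed.

Lemma closure_separable (T : topologicalType) (D : set T) :
  countable D -> separable (closure D).
Proof.
move=> /countable_injP[g ginj]; exists (set_val @^-1` D).
  apply/countable_injP; exists (g \o set_val) => x y /set_mem Dx /set_mem Dy /= gxy.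
  by apply: val_inj; apply: ginj => //; exact/mem_set.
move=> O [x Ox] Oopen.
have /nbhs_set_type xO : nbhs x O by exact: open_nbhs_nbhs.
have [y [Dy Oy]] := set_valP x _ xO.
exists (SigSub (mem_set (subset_closure Dy))); split => //.
exact: Oy.
Qed.

Theorem monolithic_c0_extension :
  aleph0_monolithic R K -> c0_extension_property CK.
Proof.
move=> mono Y Y_sub _ T /bounded_operator_ge0[M M0 TM].
(* Hahn-Banach extension of the coordinates of [T], all with the bound [M]. *)
have extend n : exists Phi : CK -> R, [/\ scalar Phi,
    forall f, `|Phi f| <= M * `|f| &
    forall y : submod Y_sub, Phi (val y) = c0_seq (T y) n].
  have [u v|a u a0||Phi Phi_lin [PhiM PhiE]] :=
      @hahn_banach _ _ (fun f : CK => M * `|f|) _ _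
        [set w | exists y : submod Y_sub, w = (val y, c0_seq (T y) n)] _.
  - by rewrite -mulrDr ler_wpM2l// ler_normD.
  - by rewrite normrZ ger0_norm// mulrCA.
  - split.
    + by exists 0; rewrite (scalar0 (c0_seqP T n)).
    + move=> a _ _ _ _ [y [-> ->]] [z [-> ->]]; exists (a *: y + z).
      by rewrite (c0_seqP T).
    + by move=> _ _ [y [-> ->]]; apply: le_trans (ler_norm _) (le_trans (c0_seq_le _ _) (TM y)).
  exists Phi; split => // [f|y]; last by apply: PhiE; exists y.
  rewrite ler_norml PhiM andbT lerNl -(scalar_opp Phi_lin).
  by rewrite (le_trans (PhiM _))// normrN.
have [Phi PhiP] := choice extend.
have supp n : exists D : set K, countable D /\ forall (f : CK) c, 0 <= c ->
    (forall x, D x -> `|C_fun f x| <= c) -> `|Phi n f| <= M * c.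
  by case: (PhiP n) => lin bnd _; have [D] := separable_support lin M0 bnd; exists D.
have [Ds DsP] := choice supp.
(* One countable set serves all the [Phi n], and by monolithicity its closure is metrizable. *)
pose D := \bigcup_n Ds n.
have Dc : countable D by apply: bigcup_countable => // n _; case: (DsP n).
have [|B BP] := metrizable_closure_base Dc.
  by apply: mono; exact: closure_separable.
have [|//||fs _ fsP] := @countable_dense_family R K CK (@C_fun R K K_compact) (closure D) B setT.
- by apply: subclosed_compact K_compact _ => //; exact: closed_closure.
- by exists 0.
- by move=> f x e _; exact: BP.
(* Each [Phi n] is bounded by [M * p], and [C(K)] is separable for the seminorm [p] although it need
   not be for its norm. *)
pose p (f : CK) := sup [set `|C_fun f x| | x in D].
have p_le (f : CK) c : 0 <= c -> (forall x, D x -> `|C_fun f x| <= c) -> p f <= c.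
  move=> c0 fc; have [D0|Dn0] := pselect (D !=set0); last first.
    rewrite /p (_ : [set _ | _ in _] = set0) ?sup0//.
    by apply/seteqP; split => // r [x Dx _]; apply: Dn0; exists x.
  apply: ge_sup; first by case: D0 => x Dx; exists `|C_fun f x|, x.
  by move=> _ [x Dx <-]; exact: fc.
have le_p (f : CK) x : D x -> `|C_fun f x| <= p f.
  move=> Dx; apply: ub_le_sup; last by exists x.
  by exists `|f| => _ [y _ <-]; exact: C_fun_le.
have p_ge0 (f : CK) : 0 <= p f.
  have [[x Dx]|Dn0] := pselect (D !=set0); first exact: le_trans (le_p f x Dx).
  rewrite /p (_ : [set _ | _ in _] = set0) ?sup0//.
  by apply/seteqP; split => // r [x Dx _]; apply: Dn0; exists x.
have p_norm (f : CK) : p f <= `|f| by apply: p_le => // x _; exact: C_fun_le.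
have [f e e0|n|y|Psi [PsiB PsiY PsiPhi]] := @sobczyk_correction R CK p M M0 fs Y Phi.
- have [j jP] := fsP f e Logic.I e0; exists j.
  apply: p_le => [|x Dx]; first exact: ltW.
  by rewrite C_funB; apply: jP; exact: subset_closure.
- case: (PhiP n) => lin _ _; split => // f.
  by case: (DsP n) => _; apply => // x Dx; apply: le_p; exists n.
- move=> /mem_set Yy.
  have -> : Phi ^~ y = c0_seq (T (Sub y Yy)).
    by apply/funext => n; case: (PhiP n) => _ _ <-; rewrite SubK.
  exact: c0_cvg.
(* The extension has the coordinates [Phi n - Psi n]: they tend to 0, and [Psi n] vanishes on
   [Y]. *)
have [n|f|S SE] := @c0_operator R CK (fun n f => Phi n f - Psi n f).
- move=> a u v; case: (PhiP n) => -> _ _; case: (PsiB n) => -> _ /=; ring.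
- exact: PsiPhi.
exists S; last first.
  move=> y; apply: c0_ext => n; rewrite SE PsiY ?subr0; first by case: (PhiP n).
  exact/set_mem/(valP y).
exists (M + M) => f; apply: sup_norm_le => [|n]; first by rewrite mulr_ge0// addr_ge0.
rewrite SE mulrDl (le_trans (ler_normB _ _))// lerD//; first by case: (PhiP n).
by case: (PsiB n) => _ /(_ f)/le_trans; apply; rewrite ler_wpM2l.
Qed.

End MonolithicExtension.

(** * Operators that do not extend *)

Lemma seq_pos_lower_bound (R : realType) (T : eqType) (m : T -> R) (s : seq T) :
  (forall x, x \in s -> 0 < m x) -> exists2 e, 0 < e & forall x, x \in s -> e <= m x.
Proof.
elim: s => [|x s IH] mpos; first by exists 1.
have [y ys|e e0 eP] := IH; first by apply: mpos; rewrite inE ys orbT.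
exists (Num.min e (m x)) => [|y].
  by rewrite lt_min e0 mpos// mem_head.
by rewrite inE ge_min => /orP[/eqP->|/eP->//]; rewrite lexx orbT.
Qed.

Section NoExtension.
Variables (R : realType) (K : topologicalType) (K_compact : compact [set: K]).
Local Notation CK := (C_space R K_compact).
Variable pi : K -> R.
Hypothesis pi_cts : continuous pi.

(** The functions that factor through [pi], a copy of the continuous functions on the compact set
    [pi(K)]. *)
Definition fibre_constant : set CK :=
  [set f | forall x y, pi x = pi y -> C_fun f x = C_fun f y].

Lemma fibre_constant_submod : submod_closed [in fibre_constant].
Proof.
split=> [|a f g /set_mem fY /set_mem gY]; first exact/mem_set.
apply/mem_set => x y xy.
by rewrite !C_funD !C_funZ (fY x y)// (gY x y).
Qed.

Lemma fibre_constant_closed : closed fibre_constant.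
Proof.
move=> f fcl x y xy; apply/eqP; rewrite -subr_eq0 -normr_le0.
apply/ler_addgt0Pl => e e0; rewrite addr0.
have [g [gY]] := fcl _ (nbhsx_ballx f (e / 2) (divr_gt0 e0 (ltr0Sn R 1))).
rewrite -ball_normE /= => fg.
have := C_fun_le (f - g) x; have := C_fun_le (f - g) y.
rewrite !C_funB (gY x y xy) !ler_norml; move: fg; lra.
Qed.

(** Each point has a neighbourhood on which either [f] stays close to [f x] or [pi] keeps half of
    its distance from [pi x]. A finite subcover leaves finitely many distances, and [r] is a lower
    bound for them. *)
Lemma fibre_constant_near f x e : fibre_constant f -> 0 < e ->
  exists2 r, 0 < r & forall y, `|pi y - pi x| < r -> `|C_fun f y - C_fun f x| < e.
Proof.
move=> fY e0.
pose U y := if `|C_fun f y - C_fun f x| < e then [set z | `|C_fun f z - C_fun f x| < e]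
  else [set z | `|pi y - pi x| / 2 < `|pi z - pi x|].
have nU y : nbhs y (U y).
  rewrite /U; case: ifPn => [fyx|fyx].
    have := @C_fun_continuous _ _ _ f y.
    have e1 : 0 < e - `|C_fun f y - C_fun f x| by rewrite subr_gt0.
    move=> /cvgrPdist_lt/(_ _ e1); apply: filterS => z /= fyz.
    rewrite -(subrK (C_fun f y) (C_fun f z)) -addrA.
    by rewrite (le_lt_trans (ler_normD _ _))// distrC -ltrBrDr.
  have pyx : 0 < `|pi y - pi x|.
    rewrite normr_gt0 subr_eq0; apply: contra fyx => /eqP/fY->.
    by rewrite subrr normr0.
  have /cvgrPdist_lt/(_ _ (divr_gt0 pyx (ltr0Sn R 1))) := @pi_cts y.
  apply: filterS => z /= pyz.
  have := ler_normD (pi y - pi z) (pi z - pi x); rewrite addrA subrK.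
  move: pyz; lra.
have [s _ scov] := compact_list_cover K_compact (fun y _ => nU y).
have [|r r0 rP] := @seq_pos_lower_bound R K
  (fun y => if `|C_fun f y - C_fun f x| < e then 1 else `|pi y - pi x| / 2) s.
  move=> y _; case: ifPn => // fyx; rewrite divr_gt0//.
  rewrite normr_gt0 subr_eq0; apply: contra fyx => /eqP/fY->.
  by rewrite subrr normr0.
exists r => // z zr; have [y ys] := scov z Logic.I; rewrite /U.
have := rP y ys; case: ifP => // _ ry /lt_trans/(_ zr).
by rewrite ltNge ry.
Qed.

(** A Lebesgue number argument: finitely many preimages of balls of half radius cover [K]. *)
Lemma fibre_constant_uniform f e : fibre_constant f -> 0 < e ->
  exists2 r, 0 < r & forall x y, `|pi x - pi y| < r -> `|C_fun f x - C_fun f y| < e.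
Proof.
move=> fY e0; have e2 : 0 < e / 2 by rewrite divr_gt0.
have H x : exists r, 0 < r /\
    forall y, `|pi y - pi x| < r -> `|C_fun f y - C_fun f x| < e / 2.
  by have [r] := fibre_constant_near x fY e2; exists r.
have [r rP] := choice H.
have nU x : nbhs x [set y | `|pi y - pi x| < r x / 2].
  have /cvgrPdist_lt/(_ (r x / 2)) := @pi_cts x; rewrite divr_gt0//; last by case: (rP x).
  by move=> /(_ isT); apply: filterS => y; rewrite distrC.
have [s _ scov] := compact_list_cover K_compact (fun y _ => nU y).
have [z _|q q0 qP] := @seq_pos_lower_bound R K (fun x => r x / 2) s.
  by rewrite divr_gt0//; case: (rP z).
exists q => // x y xy; have [z zs /= xz] := scov x Logic.I.
have [rz0 rzP] := rP z.
have xz' : `|C_fun f x - C_fun f z| < e / 2 by apply: rzP; move: xz rz0; lra.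
have yz' : `|C_fun f y - C_fun f z| < e / 2.
  apply: rzP; move: (qP z zs) xz xy; rewrite !ltr_norml; lra.
move: xz' yz'; rewrite !ltr_norml; lra.
Qed.

Local Notation Y := (submod fibre_constant_submod).

Lemma fibre_constant_val (f : Y) : fibre_constant (val f).
Proof. exact/set_mem/(valP f). Qed.

Lemma fibre_constant_separable : separable Y.
Proof.
pose B i := if unpickle i is Some (q, k) then
  [set y | `|pi y - ratr q| < (k : nat).+1%:R^-1] else set0.
have [|||fs _ fsP] := @countable_dense_family R K Y (fun f => C_fun (val f)) setT B setT.
- exact: K_compact.
- by exists 0.
- move=> f x e _ _ e0.
  have [r r0 rP] := fibre_constant_near x (fibre_constant_val f) e0.
  have [k _ /(_ k (leqnn k))/= kr] := near_infty_natSinv_lt (PosNum (divr_gt0 r0 (ltr0Sn R 1))).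
  pose s : R := k.+1%:R^-1; have s0 : 0 < s by rewrite invr_gt0.
  have [|q] := @rat_in_itvoo R (pi x - s) (pi x + s); first by move: s0; lra.
  rewrite in_itv/= => xq.
  exists (pickle (q, k)); rewrite /B pickleK.
    have e1 : 0 < s - `|pi x - ratr q| by rewrite subr_gt0 ltr_norml; move: xq; lra.
    have /cvgrPdist_lt/(_ _ e1) := @pi_cts x.
    apply: filterS => y xy _ /=; rewrite -/s.
    have := ler_normD (pi y - pi x) (pi x - ratr q); rewrite addrA subrK.
    by move: xy; rewrite distrC; lra.
  move=> y _ yq; apply/ltW/rP; move: yq kr xq; rewrite /= -/s !ltr_norml; lra.
exists (range fs); first exact: sub_countable (card_image_le _ _) _.
move=> O [f Of] Oopen; have := open_nbhs_nbhs (conj Oopen Of).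
move=> /nbhs_ballP[e /= e0 eO].
have [n nP] := fsP f _ Logic.I (divr_gt0 e0 (ltr0Sn R 1)).
exists (fs n); split; last by exists n.
apply: eO; rewrite -ball_normE /=.
apply: (@le_lt_trans _ _ (e / 2)); last by rewrite ltr_pdivrMr// ltr_pMr// ltr1n.
change (`|val (f - fs n)| <= e / 2); rewrite raddfB.
apply: C_norm_le => [|x]; first by rewrite divr_ge0// ltW.
exact: nP.
Qed.

Section Exceptional.
Variables (Phi : CK -> R) (M : R).
Hypothesis Phi_lin : scalar Phi.
Hypothesis M0 : 0 <= M.
Hypothesis PhiM : forall f, `|Phi f| <= M * `|f|.

(** More than [M / e] such values would give too many disjoint strips around their fibres that are
    not small. *)
Lemma finite_not_small_fibres e : 0 < e -> finite_set
  [set t | forall r, 0 < r -> ~ small Phi e [set x | `|pi x - t| < r]].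
Proof.
move=> e0; apply: contrapT => /(@infinite_set_fset _ _ (Num.bound (M / e)))[B Bsub Bn].
pose s : seq R := finmap.enum_fset B.
(* [r] is at most half of each distance between distinct values, which makes the strips disjoint;
   diagonal pairs get the dummy bound 1. *)
have [[x y] _|r r0 rP] := @seq_pos_lower_bound R _
    (fun xy : R * R => if xy.1 == xy.2 then 1 else `|xy.1 - xy.2| / 2)
    [seq (x, y) | x <- s, y <- s].
  by case: eqVneq => //= xy; rewrite divr_gt0// normr_gt0 subr_eq0.
have sB i : (i < size s)%N -> nth 0 s i \in s by exact: mem_nth.
have := @disjoint_not_small _ _ _ Phi M Phi_lin M0 PhiM e
  (fun i => [set x | `|pi x - nth 0 s i| < r]) (size s).
rewrite leNgt => /(_ _ _)/negP; apply.
- by move=> i /sB si; apply: (Bsub _ si).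
- move=> i j x /andP[ij js] /= xi xj.
  have is_ := ltn_trans ij js.
  have := rP (nth 0 s i, nth 0 s j) (allpairs_f pair (sB _ is_) (sB _ js)) => /=.
  rewrite nth_uniq// ?finmap.fset_uniq// (ltn_eqF ij).
  have := ler_distD (pi x) (nth 0 s i) (nth 0 s j).
  rewrite (distrC _ (pi x)); move: xi xj; lra.
rewrite -ltr_pdivrMr//; apply: (@lt_le_trans _ _ (Num.bound (M / e))%:R).
  by rewrite archi_boundP// divr_ge0// ltW.
by rewrite ler_nat.
Qed.

End Exceptional.

(** Equal to 1 up to [t - r], to 0 from [t + r] on, and linear in between when [0 < r]. *)
Definition ramp (t r s : R) : R := Num.max 0 (Num.min 1 ((t + r - s) / (2 * r))).

Lemma ramp_continuous t r : continuous (fun x => ramp t r (pi x)).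
Proof.
move=> x; apply: max_fun_continuous; first by move=> ?; exact: cvg_cst.
apply: min_fun_continuous; first by move=> ?; exact: cvg_cst.
move=> y; apply: cvgMl; apply: cvgB; first exact: cvg_cst.
exact: pi_cts.
Qed.

Lemma ramp_itv t r s : 0 <= ramp t r s <= 1.
Proof. by rewrite /ramp le_max lexx ge_max ler01 ge_min lexx. Qed.

Lemma ramp1 t r s : 0 < r -> s <= t - r -> ramp t r s = 1.
Proof.
move=> r0 st; rewrite /ramp min_l ?max_r//.
by rewrite ler_pdivlMr ?mulr_gt0// mul1r; lra.
Qed.

Lemma ramp0 t r s : 0 < r -> t + r <= s -> ramp t r s = 0.
Proof.
move=> r0 st; rewrite /ramp max_l// ge_min; apply/orP; right.
by rewrite ler_pdivrMr ?mulr_gt0// mul0r; lra.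
Qed.

(** The operator that does not extend sends [f] to the sequence of [f (a i) - f (b i)]. An extension
    would have infinitely many coordinates of absolute value at least [1 / 2] on a function dropping
    at a suitable [t] in [S]. *)
Lemma no_c0_extension (a b : nat -> K) (S : set R) :
  (fun i => pi (a i) - pi (b i)) @ \oo --> (0 : R) ->
  ~ countable S ->
  (forall t, S t -> forall N, exists2 i, (N <= i)%N & pi (a i) < t < pi (b i)) ->
  (forall t, S t -> exists f : CK, forall x, [/\ 0 <= C_fun f x <= 1,
     pi x < t -> C_fun f x = 1 & t < pi x -> C_fun f x = 0]) ->
  ~ separable_c0_extension_property CK.
Proof.
move=> ab0 Sunc Sab Sf ext.
have [||T TE] := @c0_operator R Y
    (fun i (f : Y) => C_fun (val f) (a i) - C_fun (val f) (b i)).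
- move=> i c f g.
  have E x : C_fun (val (c *: f + g)) x = c * C_fun (val f) x + C_fun (val g) x by [].
  by rewrite !E; ring.
- move=> f; apply/cvgrPdist_lt => e e0.
  have [r r0 rP] := fibre_constant_uniform (fibre_constant_val f) e0.
  have /cvgrPdist_lt/(_ r r0) := ab0.
  by apply: filterS => i; rewrite !sub0r !normrN; exact: rP.
have Tb : bounded_operator T.
  exists 2 => f; apply: sup_norm_le => [|n]; first by rewrite mulr_ge0.
  rewrite TE (le_trans (ler_normB _ _))// mulr_natl mulr2n lerD//; exact: C_fun_le.
have [V /bounded_operator_ge0[M M0 VM] VT] :=
  ext _ _ fibre_constant_closed fibre_constant_separable T Tb.
pose Phi i (f : CK) := c0_seq (V f) i.
have PhiM i f : `|Phi i f| <= M * `|f| := le_trans (c0_seq_le _ _) (VM f).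
pose E i := [set t | forall r, 0 < r -> ~ small (Phi i) (1 / 2) [set x | `|pi x - t| < r]].
(* Each [E i] is finite, so the uncountable [S] has a value outside all of them. *)
have [t [St nEt]] : exists t, S t /\ forall i, ~ E i t.
  apply: contrapT => no; apply: Sunc.
  apply: (@sub_countable _ _ _ (\bigcup_i E i)).
    apply: subset_card_le => t St; apply: contrapT => nE.
    by apply: no; exists t; split => // i Eit; apply: nE; exists i.
  apply: bigcup_countable => // i _; apply: finite_set_countable.
  by apply: finite_not_small_fibres (c0_seqP V i) M0 (PhiM i) _ _; lra.
have [f fP] := Sf t St.
have /cvgrPdist_lt/(_ (1 / 2)) := c0_cvg (V f); case; first by lra.
move=> N _ NP; have [i Ni /andP[at_ tb]] := Sab t St N.
have := NP i Ni; rewrite sub0r normrN -/(Phi i f).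
have /existsNP[r /not_implyP[r0 /contrapT r_small]] := nEt i.
(* [q <= r] confines [f - g] to the small strip; the other two bounds put [a i] and [b i] where the
   ramp is 1 and 0, so that [T] forces [Phi i g = 1]. *)
pose q := Num.min r (Num.min (t - pi (a i)) (pi (b i) - t)).
have q0 : 0 < q by rewrite !lt_min r0 !subr_gt0 at_ tb.
have [qr qa qb] : [/\ q <= r, q <= t - pi (a i) & q <= pi (b i) - t].
  by split; rewrite /q !ge_min lexx ?orbT.
pose g : CK := C_of K_compact (@ramp_continuous t q).
have gE x : C_fun g x = ramp t q (pi x) by [].
have gY : fibre_constant g by move=> x y xy; rewrite !gE xy.
have Phig : Phi i g = 1.
  have := VT (Sub g (mem_set gY)); rewrite SubK /Phi => ->.
  rewrite TE SubK !gE ramp1 ?ramp0 ?subr0//; lra.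
have : `|Phi i (f - g)| <= 1 / 2 * `|f - g|.
  apply: r_small => x; rewrite C_funB gE subr_eq0 => fg /=.
  rewrite ltNge; apply: contra fg => rx; have [_ f1 f0] := fP x.
  have [xt|xt|xt] := ltgtP (pi x) t.
  - by rewrite f1// ramp1//; move: rx; rewrite ltr0_norm ?subr_lt0//; lra.
  - by rewrite f0// ramp0//; move: rx; rewrite gtr0_norm ?subr_gt0//; lra.
  - by move: rx; rewrite xt subrr normr0 leNgt r0.
have : `|f - g| <= 1.
  apply: C_norm_le => // x; rewrite C_funB gE ler_norml.
  by have [] := fP x; have := ramp_itv t q (pi x); lra.
have PhiL : scalar (Phi i) := c0_seqP V i.
rewrite (scalar_sub PhiL) Phig.
rewrite ltr_norml ler_norml; lra.
Qed.

End NoExtension.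

(** * Jumps *)

Lemma countable_setU (T : Type) (A B : set T) :
  countable A -> countable B -> countable (A `|` B).
Proof.
move=> Ac Bc; apply: (@sub_countable _ _ _ (\bigcup_(b : bool) if b then A else B)).
  by apply: subset_card_le => x [Ax|Bx]; [exists true|exists false].
by apply: bigcup_countable => // -[].
Qed.

(** The metric is the supremum over [i] of [|fs i x - fs i y| / (i+1)]. The weights leave finitely
    many coordinates to control within a ball; compactness of [L] minus an open set bounds the
    distance from [x] to it from below. *)
Lemma metrizable_of_functions (R : realType) (K : topologicalType) (A L : set K)
    (fs : nat -> K -> R) :
  compact L -> A `<=` L -> (forall i, continuous (fs i)) ->
  (forall i x, 0 <= fs i x <= 1) ->
  (forall x y, L x -> L y -> (forall i, fs i x = fs i y) -> x = y) ->
  metrizable R A.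
Proof.
move=> cL AL fcts f01 fsep.
pose h (x y : K) i := (fs i x - fs i y) / i.+1%:R.
have h_le x y i : `|h x y i| <= i.+1%:R^-1.
  rewrite normrM normfV normr_nat ler_piMl ?invr_ge0//.
  by rewrite ler_norml; have := f01 i x; have := f01 i y; lra.
have hb x y : sup_bounded (h x y).
  exists 1 => i; apply: le_trans (h_le x y i) _.
  by rewrite invf_le1 ?ltr0n// ler1n.
have hxx x i : h x x i = 0 by rewrite /h subrr mul0r.
have hC x y i : `|h x y i| = `|h y x i| by rewrite /h !normrM distrC.
exists (fun x y : A => sup_norm (h (set_val x) (set_val y))).
  split=> [x y|x y|x y|x y z].
  - exact: sup_norm_ge0.
  - split=> [/(sup_norm_eq0 (hb _ _)) xy|->]; last first.
      apply/eqP; rewrite eq_le sup_norm_ge0// andbT.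
      by apply: sup_norm_le => // i; rewrite hxx normr0.
    apply: val_inj; apply: fsep => [||i]; [exact/AL/set_valP|exact/AL/set_valP|].
    have := xy i; rewrite /h => /eqP.
    by rewrite mulf_eq0 invr_eq0 pnatr_eq0 orbF subr_eq0 => /eqP.
  - by congr sup; apply/seteqP; split => _ [i _ <-]; exists i; rewrite // hC.
  - apply: le_trans (sup_normD (hb _ _) (hb _ _)).
    rewrite (_ : h _ _ = (fun i => h (set_val x) (set_val y) i + h (set_val y) (set_val z) i))//.
    by apply/funext => i; rewrite /h -mulrDl addrA subrK.
move=> x U; split; last first.
  move=> [e e0 eU]; apply/nbhs_set_type.
  have e2 : 0 < e / 2 by rewrite divr_gt0.
  have [N _ NP] := near_infty_natSinv_lt (PosNum e2).
  have : \forall y \near set_val x, forall i : 'I_N, `|fs i (set_val x) - fs i y| < e / 2.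
    by apply: filter_forall => i; have /cvgrPdist_lt := fcts i (set_val x); exact.
  apply: filterS => y yP z zy; apply: eU => /=; rewrite zy.
  apply: (@le_lt_trans _ _ (e / 2)); last by rewrite ltr_pdivrMr// ltr_pMr// ltr1n.
  apply: sup_norm_le => [|i]; first exact: ltW.
  have [iN|Ni] := ltnP i N; last by apply: le_trans (h_le _ _ _) (ltW (NP i Ni)).
  rewrite /h normrM normfV normr_nat; apply: le_trans (ltW (yP (Ordinal iN))).
  by rewrite ler_piMr// invf_le1 ?ltr0n// ler1n.
move=> /nbhs_set_type; rewrite nbhsE => -[W [oW Wx] WU].
have cLW : compact (L `\` W).
  by rewrite setDE; apply: compact_closedI => //; exact: open_closedC.
have H v : exists i, (L `\` W) v -> fs i (set_val x) != fs i v.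
  have [[Lv nWv]|?] := pselect ((L `\` W) v); last by exists 0%N.
  apply: contrapT => no; apply: nWv.
  suff <- : set_val x = v by [].
  apply: fsep => // [|i]; first exact/AL/set_valP.
  by apply/eqP/negPn/negP => ne; apply: no; exists i.
have [i iP] := choice H.
pose m v := `|h (set_val x) v (i v)|.
have m_gt0 v : (L `\` W) v -> 0 < m v.
  by move=> /iP xv; rewrite normr_gt0 mulf_neq0 ?subr_eq0// invr_eq0 pnatr_eq0.
have [|s sL scov] := @compact_list_cover K _
    (fun v => [set w | m v / 2 < `|h (set_val x) w (i v)|]) cLW.
  move=> v /m_gt0 mv.
  have hcts : h (set_val x) w (i v) @[w --> v] --> h (set_val x) v (i v).
    apply: cvgMl; apply: cvgB; first exact: cvg_cst.
    exact: fcts.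
  have m2 : 0 < m v / 2 by rewrite divr_gt0.
  have /cvgrPdist_lt/(_ _ m2) := hcts; apply: filterS => w /=.
  have := ler_normD (h (set_val x) v (i v) - h (set_val x) w (i v)) (h (set_val x) w (i v)).
  rewrite subrK -/(m v); lra.
have [v /sL/m_gt0 mv|e e0 eP] := @seq_pos_lower_bound R K (fun v => m v / 2) s.
  by rewrite divr_gt0.
exists e => // y /= ye; apply: (WU (set_val y)) => //; apply: contrapT => nWy.
have [v vs /= vy] := scov (set_val y) (conj (AL _ (set_valP y)) nWy).
have := lt_le_trans vy (sup_norm_ge (i v) (hb _ _)) => /(le_lt_trans (eP v vs)).
by rewrite ltNge (ltW ye).
Qed.

Section Jumps.
Variables (R : realType) (d : Order.disp_t) (K : orderTopologicalType d).
Hypothesis K_compact : compact [set: K].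
Implicit Types (x y z : K) (D : set K).

Lemma order_urysohn x y : (x < y)%O -> exists f : K -> R,
  [/\ continuous f, forall z, 0 <= f z <= 1,
      forall z, (z <= x)%O -> f z = 1 & forall z, (y <= z)%O -> f z = 0].
Proof.
move=> xy.
have nK : normal_space K := compact_normal order_hausdorff K_compact.
have [|f [fc f01 f0 f1]] := (uniform_separatorP (R := R) `[y, +oo[ `]-oo, x]).1.
  apply: (normal_separatorP (R := R)).1 => //; [exact: rray_closed|exact: lray_closed|].
  apply/seteqP; split => // z [] /=; rewrite !in_itv/= andbT => yz zx.
  by have := lt_le_trans xy (le_trans yz zx); rewrite ltxx.
exists f; split => // [z|z zx|z yz].
- by have := f01 (f z); rewrite /= in_itv/=; apply; exists z.
- by apply: f1; exists z => //=; rewrite in_itv.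
- by apply: f0; exists z => //=; rewrite in_itv/= yz.
Qed.

(* Gaps of the closure of [D] between two of its points. *)
Definition jump D : set (K * K) := [set j | [/\ closure D j.1, closure D j.2,
  (j.1 < j.2)%O & forall z, D z -> ~~ (j.1 < z < j.2)%O]].

Lemma closure_meets_itv D x y z : closure D z -> (x < z < y)%O ->
  exists2 w, D w & (x < w < y)%O.
Proof.
move=> Dz xzy; have [w [Dw wI]] : D `&` `]x, y[ !=set0.
  apply: Dz; apply: open_nbhs_nbhs; split; first exact: itv_open.
  by rewrite /= in_itv.
by exists w => //; move: wI; rewrite /= in_itv.
Qed.

(** Urysohn functions for pairs in the countable set [E] of points of [D] and ends of jumps separate
    the points of [closure D]: between any two of its points there are [u < v] in [E]. *)
Lemma countable_jumps_metrizable A D : countable D -> A `<=` closure D ->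
  countable (jump D) -> metrizable R A.
Proof.
move=> Dc AD Jc.
have [D0|/set0P Dn0] := eqVneq D set0.
  apply: (@metrizable_of_functions _ _ A (closure D) (fun _ _ => 0)) => //.
  - by apply: subclosed_compact K_compact _ => //; exact: closed_closure.
  - by move=> _ x; exact: cvg_cst.
  - by move=> _ _; rewrite lexx ler01.
  - by rewrite D0 closure0.
pose E := D `|` (fst @` jump D `|` snd @` jump D).
have Ec : countable E.
  by do 2![apply: countable_setU => //]; exact: sub_countable (card_image_le _ _) _.
have [q qP] : exists q : nat -> K * K, forall p, (E `*` E) p <-> exists n, q n = p.
  apply: countable_enum; first exact: countableX.
  by have [x Dx] := Dn0; exists (x, x); split; left.
have H n : exists f : K -> R, [/\ continuous f, forall z, 0 <= f z <= 1 &
    ((q n).1 < (q n).2)%O -> forall z,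
      ((z <= (q n).1)%O -> f z = 1) /\ (((q n).2 <= z)%O -> f z = 0)].
  have [qn|nqn] := boolP ((q n).1 < (q n).2)%O.
    have [f [fc f01 f1 f0]] := order_urysohn qn.
    by exists f; split => // _ z; split; [exact: f1|exact: f0].
  exists (fun=> 0); split => //; first by move=> x; exact: cvg_cst.
  by move=> _; rewrite lexx ler01.
have [f fP] := choice H.
apply: (@metrizable_of_functions _ _ A (closure D) f) => //.
- by apply: subclosed_compact K_compact _ => //; exact: closed_closure.
- by move=> n; case: (fP n).
- by move=> n z; case: (fP n).
suff sep x y : closure D x -> closure D y -> (x < y)%O -> ~ (forall i, f i x = f i y).
  move=> x y Dx Dy fxy; have [xy|yx|//] := ltgtP x y; first by case: (sep x y).
  by case: (sep y x).
move=> Dx Dy xy fxy.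
suff [u [v [Eu Ev uv /andP[xu vy]]]] :
    exists u v, [/\ E u, E v, (u < v)%O & (x <= u)%O && (v <= y)%O].
  have [n qn] := (qP (u, v)).1 (conj Eu Ev).
  have [_ _] := fP n; rewrite qn => /(_ uv) H01.
  have := fxy n; rewrite (H01 x).1// (H01 y).2// => /eqP.
  by rewrite oner_eq0.
have jE u v : jump D (u, v) -> E u /\ E v.
  by move=> j; split; right; [left|right]; exists (u, v).
(* With no point of [D] between [x] and [y] they form a jump. Otherwise such a [z] either forms a
   jump with [x] or has another point [w] of [D] between [x] and itself. *)
have [[z Dz /andP[xz zy]]|no] := pselect (exists2 z, D z & (x < z < y)%O); last first.
  exists x, y; rewrite !lexx; have [|Ex Ey] := jE x y; last by split.
  by split => // z Dz; apply/negP => ?; apply: no; exists z.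
have [[w Dw /andP[xw wz]]|no] := pselect (exists2 w, D w & (x < w < z)%O).
  by exists w, z; split => //; [left|left|rewrite (ltW xw) (ltW zy)].
exists x, z; rewrite lexx (ltW zy); have [|Ex Ez] := jE x z; last by split.
split => //; first exact: subset_closure.
by move=> w Dw; apply/negP => ?; apply: no; exists w.
Qed.

(** If no [x] splits [J], each [x] in [D] has only countably many jumps of [J] on one of its sides.
    Discarding all of these leaves at most one jump, since a point of [D] separating two remaining
    ones would have discarded one of them. *)
Lemma uncountable_jumps_split D (J : set (K * K)) : countable D -> J `<=` jump D ->
  ~ countable J -> exists x, [/\ D x,
    ~ countable (J `&` [set j | (j.2 <= x)%O]) &
    ~ countable (J `&` [set j | (x <= j.1)%O])].
Proof.
move=> Dc Jj Junc; apply: contrapT => no; apply: Junc.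
pose below x := J `&` [set j | (j.2 <= x)%O].
pose above x := J `&` [set j | (x <= j.1)%O].
pose D1 := D `&` [set x | countable (below x)].
pose D2 := D `&` [set x | countable (above x)].
pose rest := J `\` (\bigcup_(x in D1) below x `|` \bigcup_(x in D2) above x).
have D12 x : D x -> D1 x \/ D2 x.
  move=> Dx; apply: contrapT => /not_orP[n1 n2]; apply: no; exists x; split => //.
    by move=> c; apply: n1.
  by move=> c; apply: n2.
have rest_split j j' x : rest j -> rest j' -> D x -> ~~ (j.1 < x < j'.2)%O.
  move=> [Jj1 nj] [Jj2 nj'] /[dup] Dx /D12[D1x|D2x]; apply/negP => /andP[jx xj].
    have [_ _ _ /(_ x Dx)] := Jj _ Jj1; rewrite jx /= -leNgt => h.
    by apply: nj; left; exists x.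
  have [_ _ _ /(_ x Dx)] := Jj _ Jj2; rewrite xj andbT -leNgt => h.
  by apply: nj'; right; exists x.
have rest_le j j' : rest j -> rest j' -> (j'.1 <= j.1)%O /\ (j'.2 <= j.2)%O.
  move=> rj rj'; have [Jj1 Jj2] := (rj.1, rj'.1).
  have [c1 c2 lt1 _] := Jj _ Jj1; have [c1' c2' lt2 _] := Jj _ Jj2.
  split; rewrite leNgt; apply/negP => lt.
    have [|w Dw] := @closure_meets_itv D j.1 j'.2 j'.1 c1'; first by rewrite lt.
    exact/negP/(rest_split j j' w rj rj' Dw).
  have [|w Dw] := @closure_meets_itv D j.1 j'.2 j.2 c2; first by rewrite lt1.
  exact/negP/(rest_split j j' w rj rj' Dw).
apply: (@sub_countable _ _ _ (rest `|` (\bigcup_(x in D1) below x `|` \bigcup_(x in D2) above x))).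
  apply: subset_card_le => j Jjj.
  by have [?|?] := pselect ((\bigcup_(x in D1) below x `|` \bigcup_(x in D2) above x) j);
    [right|left].
apply: countable_setU; last apply: countable_setU.
- have [[j rj]|no'] := pselect (exists j, rest j).
    apply: (@sub_countable _ _ _ [set j]) => //; apply: subset_card_le => i ri.
    have [a1 a2] := rest_le _ _ ri rj; have [b1 b2] := rest_le _ _ rj ri.
    rewrite /=; case: i j {ri rj} a1 a2 b1 b2 => [i1 i2] [j1 j2] /= a1 a2 b1 b2.
    by congr (_, _); apply/eqP; rewrite eq_le ?a1 ?a2 ?b1 ?b2.
  suff -> : rest = set0 by [].
  by apply/seteqP; split => // j rj; apply: no'; exists j.
- apply: bigcup_countable; last by move=> x [].
  by apply: sub_countable Dc; apply: subset_card_le => x [].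
- apply: bigcup_countable; last by move=> x [].
  by apply: sub_countable Dc; apply: subset_card_le => x [].
Qed.

End Jumps.

(** * Dyadic trees *)

Section Dyadic.
Variable R : realType.

Definition dyadic (n k : nat) : R := k%:R / 2 ^+ n.

Lemma dyadic_lt n k n' k' : (dyadic n k < dyadic n' k') = (k * 2 ^ n' < k' * 2 ^ n)%N.
Proof.
rewrite /dyadic ltr_pdivrMr ?exprn_gt0// mulrAC ltr_pdivlMr ?exprn_gt0//.
by rewrite -!natrX -!natrM ltr_nat.
Qed.

Lemma dyadic_eq n k n' k' : (dyadic n k == dyadic n' k') = (k * 2 ^ n' == k' * 2 ^ n)%N.
Proof. by rewrite (eq_le (dyadic n k)) !leNgt !dyadic_lt -!leqNgt -eqn_leq. Qed.

Lemma dyadic_floor n t : 0 <= t < 1 ->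
  exists2 k, (k < 2 ^ n)%N & dyadic n k <= t < dyadic n k.+1.
Proof.
move=> /andP[t0 t1]; have p0 : 0 < 2 ^+ n :> R by rewrite exprn_gt0.
have := @truncn_itv R (t * 2 ^+ n); rewrite mulr_ge0 ?(ltW p0)// => /(_ isT).
set k := Num.truncn _ => /andP[kt tk]; exists k; last first.
  by rewrite /dyadic ler_pdivrMr// kt ltr_pdivlMr.
by rewrite -(ltr_nat R) natrX (le_lt_trans kt)// gtr_pMl.
Qed.

Lemma dyadic_between a b : 0 <= a -> a < b -> b <= 1 ->
  exists n k, (k <= 2 ^ n)%N /\ a < dyadic n k < b.
Proof.
move=> a0 ab b1; have ba0 : 0 < b - a by rewrite subr_gt0.
have [n _ /(_ n (leqnn n))/= nab] := near_infty_natSinv_expn_lt (PosNum ba0).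
have [|k kn /andP[ka ak]] := @dyadic_floor n a; first by rewrite a0 (lt_le_trans ab).
exists n, k.+1; split => //; rewrite ak /=.
have : dyadic n k.+1 = dyadic n k + 1 / 2 ^+ n.
  by rewrite /dyadic -natr1 mulrDl.
by move: nab ka; lra.
Qed.

End Dyadic.

Section DyadicTree.
Variables (R : realType) (d : Order.disp_t) (K : orderTopologicalType d).
Variables (D : set K) (J : set (K * K)) (l r : K) (q : nat -> K) (m : nat -> K -> K -> K).
Implicit Types (x y z u v : K).

(** The invariant of the tree: enough jumps lie between [u] and [v] for another splitting. *)
Definition fat u v :=
  ~ countable (J `&` [set j | (u <= j.1)%O /\ (j.2 <= v)%O]).

Hypothesis J_jump : J `<=` jump D.
Hypothesis Dl : D l.
Hypothesis Dr : D r.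
Hypothesis J_itv : forall j, J j -> (l <= j.1)%O /\ (j.2 <= r)%O.
Hypothesis J_unc : ~ countable J.
Hypothesis q_enum : forall x, D x -> exists n, q n = x.
Hypothesis mP : forall n u v, fat u v ->
  [/\ D (m n u v), fat u (m n u v) & fat (m n u v) v].
(** Preferring [q n] at level [n] ensures that no splitting point in the enumeration is passed
    over. *)
Hypothesis m_q : forall n u v, fat u (q n) -> fat (q n) v -> m n u v = q n.

(** The point over [k / 2 ^ n], meaningful for [k <= 2 ^ n]: even positions are inherited from the
    previous level, odd ones are new midpoints. *)
Fixpoint tree n k : K :=
  if n is n'.+1 then
    if odd k then m n' (tree n' k./2) (tree n' k./2.+1) else tree n' k./2
  else if k is 0 then l else r.

Lemma tree_even n k : tree n.+1 k.*2 = tree n k.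
Proof. by rewrite /= odd_double doubleK. Qed.

Lemma tree_odd n k : tree n.+1 k.*2.+1 = m n (tree n k) (tree n k.+1).
Proof. by rewrite /= odd_double uphalf_double. Qed.

Lemma fat_lt u v : fat u v -> (u < v)%O.
Proof.
move=> uv; rewrite ltNge; apply/negP => vu; apply: uv.
suff -> : J `&` [set j | (u <= j.1)%O /\ (j.2 <= v)%O] = set0 by [].
apply/seteqP; split => // j [/J_jump[_ _ jj _] [uj jv]].
by have := lt_le_trans (le_lt_trans uj jj) (le_trans jv vu); rewrite ltxx.
Qed.

Lemma fat_trans u x v : fat u x -> fat x v -> fat u v.
Proof.
move=> ux /fat_lt xv c; apply: ux; apply: sub_countable c.
apply: subset_card_le => j [Jj [uj jx]]; split => //; split => //.
exact: le_trans jx (ltW xv).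
Qed.

Lemma tree_fat n k : (k < 2 ^ n)%N -> fat (tree n k) (tree n k.+1).
Proof.
elim: n k => [|n IH] k.
  rewrite expn0 ltnS leqn0 => /eqP-> /=; rewrite /fat.
  rewrite (_ : _ `&` _ = J)//; apply/seteqP; split=> [j []//|j Jj].
  by split => //; exact: J_itv.
rewrite expnS mul2n -[k]odd_double_half => kn.
have {}kn : (k./2 < 2 ^ n)%N by move: kn; case: (odd k) => /=; lia.
have [_ fl fr] := mP n (IH _ kn).
case: (odd k); rewrite ?add1n ?add0n.
  by rewrite tree_odd -doubleS tree_even.
by rewrite tree_even tree_odd.
Qed.

Lemma tree_D n k : (k <= 2 ^ n)%N -> D (tree n k).
Proof.
elim: n k => [|n IH] [|k]//; first by rewrite /= => _; exact: IH.
move: k.+1 => {}k.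
rewrite expnS mul2n -[k]odd_double_half => kn.
case: (odd k) kn; rewrite ?add1n ?add0n => kn.
  rewrite tree_odd; have [] := mP n (@tree_fat n k./2 _) => //; lia.
by rewrite tree_even; apply: IH; lia.
Qed.

Lemma tree_lt n i j : (i < j <= 2 ^ n)%N -> (tree n i < tree n j)%O.
Proof.
elim: j => // j IH /andP[]; rewrite ltnS leq_eqVlt => /orP[/eqP->|ij] jn.
  exact/fat_lt/tree_fat.
apply: lt_trans (fat_lt (tree_fat jn)).
by apply: IH; rewrite ij ltnW.
Qed.

Lemma tree_refine n p k : tree (p + n) (k * 2 ^ p) = tree n k.
Proof.
elim: p => [|p IH]; first by rewrite expn0 muln1.
by rewrite addSn expnSr mulnA muln2 tree_even.
Qed.

Lemma tree_dyadic_lt n k n' k' : (k <= 2 ^ n)%N -> (k' <= 2 ^ n')%N ->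
  dyadic R n k < dyadic R n' k' -> (tree n k < tree n' k')%O.
Proof.
rewrite dyadic_lt => kn kn' lt.
rewrite -(tree_refine n n' k) -(tree_refine n' n k') (addnC n n').
by apply: tree_lt; rewrite lt /= expnD leq_mul2r kn' orbT.
Qed.

Lemma tree_dyadic_eq n k n' k' :
  dyadic R n k = dyadic R n' k' -> tree n k = tree n' k'.
Proof.
move=> /eqP; rewrite dyadic_eq => /eqP e.
by rewrite -(tree_refine n n' k) -(tree_refine n' n k') (addnC n n') e.
Qed.

(** The value 0 keeps the set nonempty for points below [l]. *)
Definition tree_below z : set R :=
  [set t | t = 0 \/ exists n k, [/\ (k <= 2 ^ n)%N, (tree n k <= z)%O & t = dyadic R n k]].

Definition tree_proj z : R := sup (tree_below z).

Lemma dyadic01 n k : (k <= 2 ^ n)%N -> 0 <= dyadic R n k <= 1.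
Proof.
move=> kn; rewrite /dyadic divr_ge0 ?exprn_ge0//=.
by rewrite ler_pdivrMr ?exprn_gt0// mul1r -natrX ler_nat.
Qed.

Lemma tree_below_ub z : ubound (tree_below z) 1.
Proof. by move=> t [->//|[n [k [kn _ ->]]]]; have /andP[] := dyadic01 kn. Qed.

Lemma tree_proj01 z : 0 <= tree_proj z <= 1.
Proof.
apply/andP; split.
  by apply: ub_le_sup; [exists 1; exact: tree_below_ub|left].
by apply: ge_sup; [exists 0; left|exact: tree_below_ub].
Qed.

Lemma tree_proj_ge n k z : (k <= 2 ^ n)%N -> (tree n k <= z)%O -> dyadic R n k <= tree_proj z.
Proof.
move=> kn kz; apply: ub_le_sup; first by exists 1; exact: tree_below_ub.
by right; exists n, k.
Qed.

Lemma tree_proj_le n k z : (k <= 2 ^ n)%N -> (z <= tree n k)%O -> tree_proj z <= dyadic R n k.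
Proof.
move=> kn zk; apply: ge_sup; first by exists 0; left.
move=> t [->|[n' [k' [kn' kz ->]]]]; first by have /andP[] := dyadic01 kn.
rewrite leNgt; apply/negP => /(tree_dyadic_lt kn kn').
by rewrite ltNge (le_trans kz zk).
Qed.

Lemma tree_proj_tree n k : (k <= 2 ^ n)%N -> tree_proj (tree n k) = dyadic R n k.
Proof. by move=> kn; apply/eqP; rewrite eq_le tree_proj_le ?tree_proj_ge. Qed.

Lemma lt_tree_proj n k z : (k <= 2 ^ n)%N -> dyadic R n k < tree_proj z -> (tree n k < z)%O.
Proof. by move=> kn; rewrite !ltNge; apply: contra; exact: tree_proj_le. Qed.

Lemma tree_proj_lt n k z : (k <= 2 ^ n)%N -> tree_proj z < dyadic R n k -> (z < tree n k)%O.
Proof. by move=> kn; rewrite !ltNge; apply: contra; exact: tree_proj_ge. Qed.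

Lemma tree_proj_mono x y : (x <= y)%O -> tree_proj x <= tree_proj y.
Proof.
move=> xy; apply: ge_sup; first by exists 0; left.
move=> t [->|[n [k [kn kx ->]]]]; first by have /andP[] := tree_proj01 y.
exact/tree_proj_ge/(le_trans kx xy).
Qed.

(** A monotone map with a dense set of values: a tree point over a dyadic close to the value at [z]
    bounds an open ray around [z]. *)
Lemma tree_proj_continuous : continuous tree_proj.
Proof.
move=> z; apply/cvgrPdist_le => e e0.
have /andP[z0 z1] := tree_proj01 z.
have up : \forall w \near z, tree_proj w <= tree_proj z + e.
  have [ez|ez] := leP 1 (tree_proj z + e).
    by apply: filterE => w; have /andP[_] := tree_proj01 w; move: ez; lra.
  have [|n [k [kn /andP[zk ke]]]] := dyadic_between z0 _ (ltW ez); first by rewrite ltrDl.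
  have : nbhs z [set` `]-oo, tree n k[%O].
    by apply: open_nbhs_nbhs; split; [exact: lray_open|rewrite /= in_itv/= tree_proj_lt].
  apply: filterS => w; rewrite /= in_itv/= => /ltW/(tree_proj_le kn).
  by move: ke; lra.
have low : \forall w \near z, tree_proj z - e <= tree_proj w.
  have [ez|ez] := leP (tree_proj z - e) 0.
    by apply: filterE => w; have /andP[+ _] := tree_proj01 w; move: ez; lra.
  have [|n [k [kn /andP[ke kz]]]] := dyadic_between (ltW ez) _ z1.
    by rewrite ltrBlDr ltrDl.
  have : nbhs z [set` `]tree n k, +oo[%O].
    apply: open_nbhs_nbhs; split; first exact: rray_open.
    by rewrite /= in_itv/= andbT lt_tree_proj.
  apply: filterS => w; rewrite /= in_itv/= andbT => /ltW/(tree_proj_ge kn).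
  by move: ke; lra.
by apply: filterS2 up low => w; rewrite ler_norml; lra.
Qed.

(** A dyadic strictly between the two values would put a tree point, hence a point of [D], inside
    the jump. *)
Lemma tree_proj_jump j : jump D j -> tree_proj j.1 = tree_proj j.2.
Proof.
move=> [_ _ j12 jD]; apply/eqP; rewrite eq_le tree_proj_mono ?(ltW j12)//=.
rewrite leNgt; apply/negP => lt.
have /andP[t0 _] := tree_proj01 j.1; have /andP[_ t1] := tree_proj01 j.2.
have [n [k [kn /andP[jk kj]]]] := dyadic_between t0 lt t1.
by have /negP := jD _ (tree_D kn); rewrite tree_proj_lt ?lt_tree_proj.
Qed.

(* If [J'] were uncountable, some [x = q n] would split it into two uncountable
   parts, hence would be a midpoint of the tree at level [n]. *)
Lemma unsplit_countable J' : countable D -> J' `<=` J ->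
  (forall n k, (k <= 2 ^ n)%N ->
    (forall j, J' j -> (j.2 <= tree n k)%O) \/ (forall j, J' j -> (tree n k <= j.1)%O)) ->
  countable J'.
Proof.
move=> Dc J'J uns; apply: contrapT => J'unc.
have J'jump : J' `<=` jump D by move=> j /J'J/J_jump.
have [x [Dx xl xr]] := uncountable_jumps_split Dc J'jump J'unc.
have [n qn] := q_enum Dx.
have J'lt j : J' j -> (j.1 < j.2)%O by move=> /J'jump[].
have [i [j [[J'i ix] [J'j xj]]]] : exists i j,
    (J' i /\ (i.2 <= x)%O) /\ (J' j /\ (x <= j.1)%O).
  have ne A : ~ countable A -> exists i : K * K, A i.
    move=> Aunc; apply: contrapT => no; apply: Aunc.
    by rewrite (_ : A = set0)//; apply/seteqP; split => // a Aa; apply: no; exists a.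
  by have [i ?] := ne _ xl; have [j ?] := ne _ xr; exists i, j.
(* Two consecutive points of level [n] enclose [J']; otherwise, by induction on [k], all of [J']
   would lie above the last point [r]. *)
have [k kn [ka kb]] : exists2 k, (k < 2 ^ n)%N &
    (forall j, J' j -> (tree n k <= j.1)%O) /\ (forall j, J' j -> (j.2 <= tree n k.+1)%O).
  apply: contrapT => no.
  suff H k : (k <= 2 ^ n)%N -> forall j, J' j -> (tree n k <= j.1)%O.
    have := H _ (leqnn _) _ J'i; rewrite -[(2 ^ n)%N]muln1 mulnC.
    have := tree_refine 0 n 1; rewrite addn0 => -> /= ri.
    have [_ ir] := J_itv (J'J _ J'i).
    by have := lt_le_trans (le_lt_trans ri (J'lt _ J'i)) ir; rewrite ltxx.
  elim: k => [_ j' J'j'|k IH kn].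
    have := tree_refine 0 n 0; rewrite addn0 mul0n => ->.
    by have [] := J_itv (J'J _ J'j').
  have [below|//] := uns n _ kn; exfalso; apply: no; exists k => //.
  by split => //; exact/IH/ltnW.
have mE : tree n.+1 k.*2.+1 = x.
  rewrite tree_odd -qn; apply: m_q; rewrite qn => c.
    apply: xl; apply: sub_countable c; apply: subset_card_le => a [J'a ax].
    by split; [exact: J'J|split => //; exact: ka].
  apply: xr; apply: sub_countable c; apply: subset_card_le => a [J'a ax].
  by split; [exact: J'J|split => //; exact: kb].
have [|H|H] := uns n.+1 k.*2.+1; first by rewrite expnS; lia.
  have := H _ J'j; rewrite mE => jx.
  by have := lt_le_trans (J'lt _ J'j) (le_trans jx xj); rewrite ltxx.
have := H _ J'i; rewrite mE => xi.
by have := lt_le_trans (J'lt _ J'i) (le_trans ix xi); rewrite ltxx.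
Qed.

End DyadicTree.

(** * Uncountably many jumps, and the equivalence *)

Theorem uncountable_jumps_no_extension (R : realType) (d : Order.disp_t)
    (K : orderTopologicalType d) (K_compact : compact [set: K]) (D : set K) :
  countable D -> ~ countable (jump D) ->
  ~ separable_c0_extension_property (C_space R K_compact).
Proof.
move=> Dc jump_unc.
(* Two splittings provide end points in [D] with uncountably many jumps between them. *)
have [l [Dl _ J1_unc]] := uncountable_jumps_split Dc (@subset_refl _ _) jump_unc.
have [r [Dr J_unc _]] := uncountable_jumps_split Dc (@subIsetl _ _ _) J1_unc.
set J := (X in ~ countable X) in J_unc.
have J_jump : J `<=` jump D by move=> j [[]].
have J_itv j : J j -> (l <= j.1)%O /\ (j.2 <= r)%O by move=> [[]].
have [q qP] := countable_enum Dc (ex_intro _ l Dl).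
have q_enum x : D x -> exists n, q n = x by move=> /qP.
have H (w : nat * K * K) : exists x, fat J w.1.2 w.2 ->
    [/\ D x, fat J w.1.2 x, fat J x w.2 &
        fat J w.1.2 (q w.1.1) -> fat J (q w.1.1) w.2 -> x = q w.1.1].
  have [uv|?] := pselect (fat J w.1.2 w.2); last by exists l.
  have [[uq qv]|nq] := pselect (fat J w.1.2 (q w.1.1) /\ fat J (q w.1.1) w.2).
    by exists (q w.1.1) => _; split => //; apply/qP; exists w.1.1.
  have [|x [Dx xl xr]] := uncountable_jumps_split Dc _ uv; first by move=> j [/J_jump].
  exists x => _; split => // [c|c|uq qv]; last by exfalso; exact: nq.
    apply: xl; apply: sub_countable c; apply: subset_card_le.
    by move=> j [[Jj [uj _]] jx].
  apply: xr; apply: sub_countable c; apply: subset_card_le.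
  by move=> j [[Jj [_ jv]] xj].
have {H} [m0 m0P] := choice H.
pose m n u v := m0 (n, u, v).
have mP n u v : fat J u v -> [/\ D (m n u v), fat J u (m n u v) & fat J (m n u v) v].
  by move=> /(m0P (n, u, v))[? ? ? _].
have m_q n u v : fat J u (q n) -> fat J (q n) v -> m n u v = q n.
  move=> uq qv; have [_ _ _] := m0P (n, u, v) (fat_trans J_jump uq qv).
  exact.
pose pi : K -> R := tree_proj R l r m.
have pi_cts : continuous pi.
  exact: (tree_proj_continuous J_jump J_itv J_unc mP).
have pi_jump j : J j -> pi j.1 = pi j.2.
  by move=> Jj; exact: (tree_proj_jump R J_jump Dl Dr J_itv J_unc mP (J_jump _ Jj)).
have tree_inD n k : (k <= 2 ^ n)%N -> D (tree l r m n k).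
  exact: (tree_D Dl Dr J_itv J_unc mP).
have jump_side n k j : (k <= 2 ^ n)%N -> J j ->
    (j.2 <= tree l r m n k)%O \/ (tree l r m n k <= j.1)%O.
  move=> kn /J_jump[_ _ _ /(_ _ (tree_inD _ _ kn))].
  by rewrite negb_and -!leNgt => /orP[]; [right|left].
have tree_le n k j : (k <= 2 ^ n)%N -> J j -> pi j.1 < dyadic R n k ->
    (j.2 <= tree l r m n k)%O.
  move=> kn Jj /(tree_proj_lt kn) jk.
  by have [//|] := jump_side n k j kn Jj; rewrite leNgt jk.
have le_tree n k j : (k <= 2 ^ n)%N -> J j -> dyadic R n k < pi j.1 ->
    (tree l r m n k <= j.1)%O.
  by move=> kn _ /(lt_tree_proj J_jump J_itv J_unc mP kn)/ltW.
(* A tree point over another value has all jumps of value [t] on one side, so only tree points over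
   [t] could split [A]. *)
have fibre_part_countable t A : A `<=` J -> (forall j, A j -> pi j.1 = t) ->
    (forall n k, (k <= 2 ^ n)%N -> dyadic R n k = t ->
      (forall j, A j -> (j.2 <= tree l r m n k)%O) \/
      (forall j, A j -> (tree l r m n k <= j.1)%O)) -> countable A.
  move=> AJ At Aside.
  apply: (unsplit_countable J_jump J_itv J_unc q_enum m_q Dc AJ) => n k kn.
  have [kt|tk|kt] := ltgtP (dyadic R n k) t; last exact: Aside.
    by right => j Aj; apply: le_tree => //; [exact: AJ|rewrite At].
  by left => j Aj; apply: tree_le => //; [exact: AJ|rewrite At].
(* If [t] is dyadic, the tree point over it divides the jumps of value [t] into two unsplit
   parts. *)
have fibre_countable t : countable (J `&` [set j | pi j.1 = t]).
  have [[n [k [kn kt]]]|no] := pselect (exists n k, (k <= 2 ^ n)%N /\ dyadic R n k = t);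
    last first.
    apply: (fibre_part_countable t) => [j []//|j []//|n k kn kt].
    by exfalso; apply: no; exists n, k.
  pose Jt := J `&` [set j | pi j.1 = t].
  apply: (@sub_countable _ _ _ (Jt `&` [set j | (j.2 <= tree l r m n k)%O] `|`
                                Jt `&` [set j | (tree l r m n k <= j.1)%O])).
    apply: subset_card_le => j Jj.
    by have [h|h] := jump_side n k j kn Jj.1; [left|right].
  have same n' k' : dyadic R n' k' = t -> tree l r m n' k' = tree l r m n k.
    by rewrite -kt; exact: tree_dyadic_eq.
  apply: countable_setU; apply: (fibre_part_countable t).
  - by move=> j [[]].
  - by move=> j [[]].
  - by move=> n' k' _ /same ->; left => j [].
  - by move=> j [[]].
  - by move=> j [[]].
  - by move=> n' k' _ /same ->; right => j [].
(* Dyadic values are removed so that at every level a value in [S] lies strictly between two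
   consecutive tree values. *)
pose dyadics := [set t | exists w : nat * nat, dyadic R w.1 w.2 = t].
have dyadics_countable : countable dyadics.
  apply: (@sub_countable _ _ _ (range (fun w : nat * nat => dyadic R w.1 w.2))).
    by apply: subset_card_le => t [w wt]; exists w.
  exact: sub_countable (card_image_le _ _) _.
pose S := [set t | (exists2 j, J j & pi j.1 = t) /\ ~ dyadics t].
have S_unc : ~ countable S.
  move=> Sc; apply: J_unc.
  apply: (@sub_countable _ _ _ (\bigcup_(t in S `|` dyadics) (J `&` [set j | pi j.1 = t]))).
    apply: subset_card_le => j Jj; exists (pi j.1) => //.
    have [?|?] := pselect (dyadics (pi j.1)); [by right|left; split => //].
    by exists j.
  apply: bigcup_countable => [|t _]; last exact: fibre_countable.
  exact: countable_setU.
have pi_tree n k : (k <= 2 ^ n)%N -> pi (tree l r m n k) = dyadic R n k.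
  exact: (tree_proj_tree R J_jump J_itv J_unc mP).
(* The index [2 ^ n + k] with [k < 2 ^ n] codes the consecutive points [k] and [k + 1] of level
   [n]. *)
pose a i := tree l r m (trunc_log 2 i) (i - 2 ^ trunc_log 2 i).
pose b i := tree l r m (trunc_log 2 i) (i - 2 ^ trunc_log 2 i).+1.
apply: (no_c0_extension pi_cts (a := a) (b := b) (S := S)) => //.
- apply/cvgrPdist_lt => e e0.
  have [N _ NP] := near_infty_natSinv_expn_lt (PosNum e0).
  exists (2 ^ N)%N => // i /= Ni.
  have iN : (N <= trunc_log 2 i)%N by exact: trunc_log_max.
  have i_lt : (i - 2 ^ trunc_log 2 i < 2 ^ trunc_log 2 i)%N.
    have := @trunc_log_ltn 2 i isT; rewrite expnS.
    have : (0 < 2 ^ trunc_log 2 i)%N by rewrite expn_gt0.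
    lia.
  rewrite /a /b !pi_tree ?(ltnW i_lt)//.
  rewrite sub0r opprB /dyadic -mulrBl -natr1 addrAC subrr add0r.
  by rewrite ger0_norm ?divr_ge0 ?exprn_ge0//; exact: NP.
- move=> t [[j Jj jt] ndt] N.
  have ne n k : dyadic R n k != t by apply/eqP => h; apply: ndt; exists (n, k).
  have /andP[t0 t1] : 0 <= t <= 1 by rewrite -jt; exact: tree_proj01.
  have [|k kN /andP[kt tk]] := @dyadic_floor R N t.
    rewrite t0 lt_neqAle t1 andbT eq_sym.
    by have := ne 0%N 1%N; rewrite /dyadic expr0 divr1.
  have iE : trunc_log 2 (2 ^ N + k) = N.
    by apply: trunc_log_eq; rewrite // leq_addr expnS mul2n -addnn ltn_add2l.
  exists (2 ^ N + k)%N; first exact: leq_trans (ltnW (ltn_expl N _)) (leq_addr _ _).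
  rewrite /a /b iE addKn !pi_tree ?(ltnW kN)//.
  by rewrite lt_neqAle ne kt.
- move=> t [[j Jj jt] _].
  have [_ _ j12 _] := J_jump _ Jj.
  have [f [fc f01 f1 f0]] := order_urysohn R K_compact j12.
  exists (C_of K_compact fc) => x; split => [|xt|tx]; first exact: f01.
    apply: f1; rewrite leNgt; apply/negP => /ltW.
    by move=> /(@tree_proj_mono R _ _ l r m); rewrite leNgt -/(pi _) -/(pi _) jt xt.
  apply: f0; rewrite leNgt; apply/negP => /ltW.
  move=> /(@tree_proj_mono R _ _ l r m); rewrite leNgt.
  by rewrite -/(pi _) -/(pi _) -(pi_jump _ Jj) jt tx.
Qed.

Theorem theorem2p2 (R : realType) (d : Order.disp_t)
    (K : orderTopologicalType d)
    (K_nonempty : [set: K] !=set0) (K_compact : compact [set: K]) :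
  [<-> aleph0_monolithic R K;
       c0_extension_property (C_space R K_compact);
       separable_c0_extension_property (C_space R K_compact)].
Proof.
tfae.
- exact: monolithic_c0_extension.
- by move=> ext Y Y_sub Y_closed _; exact: ext.
move=> ext A [D0 D0c D0dense].
(* The dense subset of [A] moved to [K]: its closure contains [A], and (c) excludes uncountably many
   jumps. *)
pose D := set_val @` D0.
have Dc : countable D by exact: sub_countable (card_image_le _ _) D0c.
apply: (countable_jumps_metrizable R K_compact Dc).
  move=> x Ax U xU.
  have xU' : nbhs (SigSub (mem_set Ax) : A) (set_val @^-1` U).
    by apply/nbhs_set_type; apply: filterS xU => y Uy z zy; rewrite /= zy.
  move: xU'; rewrite nbhsE => -[V [oV Vx] VU].
  have [y [Vy Dy]] := D0dense V (ex_intro _ _ Vx) oV.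
  by exists (set_val y); split; [exists y|exact: VU].
by apply: contrapT => unc; exact: (uncountable_jumps_no_extension Dc unc ext).
Qed.
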